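(* Let $D$ be a graded digraph on $n$ vertices with a graded partition $V(D)=V_1\cup\dots\cup V_h$ for some $h\in\mathbb{N}$, and with maximum in-degree $\Delta^-$ and maximum out-degree $\Delta^+$. Moreover, for each $i\in\{1,\dots,h-1\}$ let $\Delta_i^-$ be the maximum in-degree in the induced subgraph $D[V_i\cup V_{i+1}]$, and set $\Delta_0^-=\Delta_h^-=0$. Then $$\vec{r}(D)\leq 10^9 (\Delta^-)^2\Delta^+ \sum_{i=1}^h 2^{2(\Delta_{i-1}^-+\Delta_i^-)}|V_i|.$$
   Context: All digraphs are finite. A digraph $D$ is graded with graded partition $V(D)=V_1\cup\dots\cup V_h$ (a partition into disjoint parts) if every edge of $D$ is directed from $V_i$ to $V_{i+1}$ for some $i\in\{1,\dots,h-1\}$. Graded digraphs are acyclic. A tournament on $N$ vertices is an orientation of the edges of the complete graph $K_N$. For an acyclic digraph $D$, the oriented Ramsey number $\vec{r}(D)$ is the minimum $N$ such that every tournament on $N$ vertices contains a copy of $D$, i.e. $D$ as a (not necessarily induced) subdigraph.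
   Formalization: The digraph D is assumed to have at least one edge; for an edgeless D on n ≥ 1 vertices both maximum degrees are 0, so the stated bound is 0 while the oriented Ramsey number is n, and the claim fails. *)

(* Defs.v *)
From mathcomp Require Import all_boot.

Set Implicit Arguments.
Unset Strict Implicit.
Unset Printing Implicit Defensive.

(* A finite digraph is a relation D : rel T on a finType T, D x y meaning that
   there is an edge directed from x to y. *)

Definition in_degree (T : finType) (D : rel T) (v : T) : nat :=
  #|[set u | D u v]|.

Definition out_degree (T : finType) (D : rel T) (v : T) : nat :=
  #|[set w | D v w]|.

Definition max_in_degree (T : finType) (D : rel T) : nat :=
  \max_(v : T) in_degree D v.

Definition max_out_degree (T : finType) (D : rel T) : nat :=
  \max_(v : T) out_degree D v.

Definition induced (T : finType) (D : rel T) (A : {set T}) :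
  rel {x : T | x \in A} := relpre val D.
Arguments induced {T} D A.

Definition acyclic (T : finType) (D : rel T) : Prop :=
  forall c : seq T, cycle D c -> c = [::].

(* The parts are V 1, ..., V h, the values of V outside 1..h being irrelevant;
   parts are allowed to be empty. *)
Definition graded_partition (T : finType) (D : rel T) (h : nat)
    (V : nat -> {set T}) : Prop :=
  [/\ \bigcup_(1 <= i < h.+1) V i = [set: T],
      forall i j, 1 <= i <= h -> 1 <= j <= h -> i != j ->
        [disjoint V i & V j]
    & forall x y, D x y ->
        exists2 i, 1 <= i <= h - 1 & (x \in V i) && (y \in V i.+1)].

Definition layer_in_degree (T : finType) (D : rel T) (h : nat)
    (V : nat -> {set T}) (i : nat) : nat :=
  if 1 <= i <= h - 1
  then max_in_degree (induced D (V i :|: V i.+1)) else 0.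

Definition tournament (W : finType) (t : rel W) : bool :=
  [forall x, ~~ t x x] && [forall x, forall y, (x != y) ==> t x y (+) t y x].

Definition contains_copy (T W : finType) (D : rel T) (t : rel W) : bool :=
  [exists f : {ffun T -> W},
     injectiveb f && [forall x, forall y, D x y ==> t (f x) (f y)]].

Definition unavoidable (T : finType) (D : rel T) (N : nat) : bool :=
  [forall E : {set 'I_N * 'I_N},
     let t := [rel x y | (x, y) \in E] in tournament t ==> contains_copy D t].

Lemma tournamentP (W : finType) (t : rel W) :
  reflect (irreflexive t /\ forall x y, x != y -> t x y = ~~ t y x)
          (tournament t).
Proof.
apply: (iffP andP) => -[].
  move=> /forallP irr /forallP tot; split=> [x|x y xy]; first exact/negbTE/irr.
  by have /forallP/(_ y)/implyP/(_ xy) := tot x; case: (t x y); case: (t y x).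
move=> irr tot; split; first by apply/forallP => x; rewrite irr.
apply/'forall_forallP => x y; apply/implyP => xy.
by rewrite tot //; case: (t y x).
Qed.

Lemma contains_copyP (T W : finType) (D : rel T) (t : rel W) :
  reflect (exists2 f : T -> W, injective f & {homo f : x y / D x y >-> t x y})
          (contains_copy D t).
Proof.
apply: (iffP existsP) => [[f /andP[/injectiveP fi /'forall_forallP fD]]|[f fi fD]].
  by exists f => // x y; apply/implyP/fD.
exists (finfun f); apply/andP; split.
  by apply/injectiveP => x y; rewrite !ffunE => /fi.
by apply/'forall_forallP => x y; apply/implyP; rewrite !ffunE; apply: fD.
Qed.

Lemma unavoidableP (T : finType) (D : rel T) (N : nat) :
  reflect (forall (W : finType) (t : rel W),
             #|W| = N -> tournament t -> contains_copy D t)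
          (unavoidable D N).
Proof.
apply: (iffP forallP) => [H W t WN /tournamentP[irr tot]|H E]; last first.
  by apply/implyP; apply: H; rewrite card_ord.
subst N.
pose E := [set p : 'I_#|W| * 'I_#|W| | t (enum_val p.1) (enum_val p.2)].
have tE : tournament [rel x y | (x, y) \in E].
  apply/tournamentP; split=> [x|x y xy] /=; rewrite !inE ?irr //=.
  by rewrite tot // (inj_eq enum_val_inj).
have /contains_copyP[f fi fD] := implyP (H E) tE.
apply/contains_copyP; exists (fun x => enum_val (f x)) => [x y /enum_val_inj/fi//|x y Dxy].
by have := fD x y Dxy; rewrite /= inE.
Qed.

Lemma transitive_subtournament (W : finType) (t : rel W) n (S : {set W}) :
    tournament t -> 2 ^ n <= #|S| ->
  exists s : seq W,
    [/\ size s = n.+1, uniq s, pairwise t s & {subset s <= S}].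
Proof.
move=> /tournamentP[irr tot]; elim: n S => [|n IHn] S leS.
  have /card_gt0P[v vS]: 0 < #|S| by [].
  by exists [:: v]; split=> // x; rewrite inE => /eqP->.
have /card_gt0P[v vS]: 0 < #|S| by apply: leq_trans leS; rewrite expn_gt0.
pose A := [set w in S | t v w]; pose B := [set w in S | t w v].
have SAB : S \subset v |: (A :|: B).
  apply/subsetP => w wS; rewrite !inE wS /=.
  by case: eqVneq => //= wv; rewrite (tot w v) //; case: (t v w).
have leAB : 2 ^ n.+1 <= 1 + (#|A| + #|B|).
  apply: leq_trans leS _; apply: leq_trans (subset_leq_card SAB) _.
  by apply: leq_trans (leq_card_setU _ _) _; rewrite cards1 leq_add2l leq_card_setU.
have : (2 ^ n <= #|A|) || (2 ^ n <= #|B|).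
  case: leqP => //= ltA; rewrite leqNgt; apply/negP => ltB.
  have := leq_add ltA ltB; rewrite addnn -mul2n -expnS => /leq_trans/(_ leAB).
  by rewrite addSn addnS add1n ltnn.
case/orP=> /IHn[s [ss us ps sub]].
  have ts w : w \in s -> t v w by move/sub; rewrite inE => /andP[].
  exists (v :: s); split=> /=; first by rewrite ss.
  - by rewrite us andbT; apply/negP => /ts; rewrite irr.
  - by rewrite ps andbT; apply/allP.
  - by move=> w; rewrite inE => /predU1P[->//|/sub]; rewrite inE => /andP[].
have ts w : w \in s -> t w v by move/sub; rewrite inE => /andP[].
exists (rcons s v); split; first by rewrite size_rcons ss.
- by rewrite rcons_uniq us andbT; apply/negP => /ts; rewrite irr.
- by rewrite pairwise_rcons ps andbT; apply/allP.
- by move=> w; rewrite mem_rcons inE => /predU1P[->//|/sub]; rewrite inE => /andP[].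
Qed.

Lemma acyclic_unavoidable (T : finType) (D : rel T) :
  acyclic D -> exists N, unavoidable D N.
Proof.
move=> acD; exists (2 ^ #|T|); apply/unavoidableP => W t WN tt.
have [|q [sq uq pq _]] := @transitive_subtournament W t #|T| [set: W] tt.
  by rewrite cardsT WN.
have w0 : W by case: q sq {uq pq}.
pose anc x := #|[set z | connect D z x]|.
have ancD x y : D x y -> anc x < anc y.
  move=> Dxy; apply: proper_card; apply/properP; split.
    by apply/subsetP => z; rewrite !inE => /connect_trans; apply; apply: connect1.
  exists y; rewrite !inE ?connect0 //; apply/negP => /connectP[p pp xE].
  have /acD // : cycle D (y :: p).
  by rewrite /= rcons_path pp -xE.
pose s := sort (relpre anc leq) (enum T).
have ins x : x \in s by rewrite mem_sort mem_enum.
have srt : sorted (relpre anc leq) s by apply: sort_sorted => x y; apply: leq_total.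
have lt x : index x s < size q.
  by rewrite sq ltnS; apply: leq_trans (index_size _ _) _; rewrite size_sort -cardE.
apply/contains_copyP; exists (fun x => nth w0 q (index x s)).
  move=> x y /eqP; rewrite nth_uniq // => /eqP /(congr1 (nth x s)).
  by rewrite !nth_index.
move=> x y Dxy; move/(pairwiseP w0): pq; apply; rewrite ?inE //.
rewrite ltnNge; apply/negP => le.
suff: anc y <= anc x by rewrite leqNgt ancD.
have tr : transitive (relpre anc leq) by move=> a b c; apply: leq_trans.
have rf : reflexive (relpre anc leq) by move=> a /=.
have := sorted_leq_nth tr rf x srt (index y s) (index x s).
by rewrite !nth_index //= !inE !index_mem; apply.
Qed.

Lemma graded_acyclic (T : finType) (D : rel T) (h : nat)
    (V : nat -> {set T}) :
  graded_partition D h V -> acyclic D.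
Proof.
case=> _ dis edge.
have uni x i j : 1 <= i <= h -> 1 <= j <= h -> x \in V i -> x \in V j -> i = j.
  move=> hi hj xi xj; apply/eqP; apply/negPn/negP => ij.
  by have /disjointFr/(_ xi) := dis _ _ hi hj ij; rewrite xj.
have bnd i : 1 <= i <= h - 1 -> (1 <= i <= h) && (1 <= i.+1 <= h).
  rewrite subn1 => /andP[i1 le]; rewrite i1 /=.
  have lt : i < h by case: h le {dis edge uni} => [|h] //=; case: i i1.
  by rewrite ltnW.
have walk p x i : 1 <= i <= h -> x \in V i -> path D x p ->
    (last x p \in V (i + size p)) && (1 <= i + size p <= h).
  elim: p x i => [|y p IHp] x i hi xi /=; first by rewrite addn0 xi.
  case/andP=> /edge[j /bnd/andP[hj hj1] /andP[xj yj]] pp.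
  have ij := uni _ _ _ hi hj xi xj; subst j.
  by rewrite addnS -addSn; apply: IHp.
case=> [//|x p] /= cyc; exfalso.
have [i hi xi] : exists2 i, 1 <= i <= h & x \in V i.
  case: p cyc => [|y p] /= /andP[/edge[i /bnd/andP[hi _] /andP[xi _]] _];
  by exists i.
have /andP[] := walk _ _ _ hi xi cyc; rewrite last_rcons size_rcons => xj hj.
have /eqP := uni _ _ _ hi hj xi xj.
by rewrite addnS -[X in X == _]addn0 -addnS eqn_add2l.
Qed.

Definition oriented_ramsey (T : finType) (D : rel T) (acD : acyclic D) : nat :=
  ex_minn (acyclic_unavoidable acD).

(* Main.v *)
Require Import Defs.
From mathcomp Require Import all_boot zify.

(* Take a median order of the tournament: for every vertex v and every interval
   immediately preceding v, at least half of that interval dominates v. Going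
   down from the last layer, choose disjoint blocks of this order and dense
   subsets A_h, ..., A_1 of them. Given A_{i+1}, which lies in a short block,
   the preceding interval sends about half of its edges to A_{i+1}, so the
   common in-neighbourhood A_i of q_i random vertices of A_{i+1} (dependent
   random choice) has relative density about 2^-q_i in its block, and very few
   small tuples of A_i have fewer than 2^-p_i |A_{i+1}| common out-neighbours
   in A_{i+1}. The layers are then embedded from the first to the last. When
   layer i is embedded, a vertex with in-neighbours has a set of candidates of
   relative size at least 2^-p_{i-1} in A_i, and a counting argument of
   Rosenfeld, in place of the local lemma, yields distinct candidates avoiding
   all bad tuples.

   With d_i the maximum in-degree between layers i and i+1, the exponents are
   p_i = d_i + min(d_i, d_{i-1}) + 16 and
   q_i = max(2 d_i, d_{i-1} + min(d_{i-1}, d_{i-2}), log(Delta^+) / 2).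
   If d_i is small compared with d_{i-1} then 2^(p_{i-1} + q_i) |V_i| may exceed
   the summand of layer i, but as at most Delta^+ |V_{i-1}| vertices of layer i
   have an in-neighbour, the excess is paid for by the summand of layer i-1. *)

Set Implicit Arguments.
Unset Strict Implicit.
Unset Printing Implicit Defensive.

(** * Median orders *)

Section MedianOrder.
Variables (W : finType) (t : rel W).

Fixpoint forward_edges (s : seq W) : nat :=
  if s is x :: s' then count (t x) s' + forward_edges s' else 0.

(** Median orders are usually defined as those with the most forward edges. Only a consequence is
    kept, for intervals that end just before [v]. *)
Definition median_order (s : seq W) : Prop :=
  forall s1 s2 v s3, s = s1 ++ s2 ++ v :: s3 -> size s2 <= 2 * count (t^~ v) s2.

Lemma forward_edges_cat s1 s2 :
  forward_edges (s1 ++ s2) =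
    forward_edges s1 + forward_edges s2 + \sum_(x <- s1) count (t x) s2.
Proof.
by elim: s1 => [|x s1 IH] /=; rewrite ?big_nil ?big_cons ?count_cat ?IH; lia.
Qed.

(** An order with the most forward edges works: moving [v] to the front of [s2] loses the edges from
    [s2] to [v] and gains those from [v] to [s2], so the former are at least half. *)
Lemma median_order_exists :
  tournament t -> exists2 s, perm_eq s (enum W) & median_order s.
Proof.
move=> /tournamentP[irr tot].
have sz : size (enum W) == #|W| by rewrite cardE.
have [x px xmax] := @arg_maxnP _ (Tuple sz)
  (fun x : #|W|.-tuple W => perm_eq x (enum W)) (fun x => forward_edges x)
  (perm_refl _).
exists x => // s1 s2 v s3 xE.
have px' : perm_eq (s1 ++ v :: s2 ++ s3) (enum W).
  apply: perm_trans px; rewrite xE perm_cat2l -cat_cons perm_sym.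
  by rewrite -cat1s catA perm_cat2r perm_catC.
have sz' : size (s1 ++ v :: s2 ++ s3) == #|W|.
  by rewrite (perm_size px') cardE.
have := xmax (Tuple sz') px'; rewrite /= xE !forward_edges_cat /=.
rewrite !forward_edges_cat !count_cat /=.
have -> : \sum_(x0 <- s1) count (t x0) (v :: s2 ++ s3) =
          \sum_(x0 <- s1) count (t x0) (s2 ++ v :: s3).
  by apply: eq_bigr => y _; rewrite /= !count_cat /=; lia.
have -> : \sum_(x0 <- s2) count (t x0) (v :: s3) =
          count (t^~ v) s2 + \sum_(x0 <- s2) count (t x0) s3.
  rewrite -sum1_count [X in X + _]big_mkcond -big_split.
  by apply: eq_bigr => y _ /=; case: t.
have vs : v \notin s2.
  have : uniq x by rewrite (perm_uniq px) enum_uniq.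
  rewrite xE !cat_uniq /= negb_or => /and3P[_ _ /and3P[_ /andP[vs _] _]].
  by [].
have cE : count (t^~ v) s2 + count (t v) s2 = size s2.
  rewrite -(count_predC (t^~ v)); congr (_ + _); apply: eq_in_count => y ys.
  by rewrite /= tot //; apply: contraNneq vs => ->.
lia.
Qed.

End MedianOrder.

(** * Averaging inequalities *)

(** By averaging over the [m] consecutive blocks of length [b]. It localizes a dense interval to one
    short block. *)
Lemma heavy_block (T : Type) (g : T -> nat) (m b : nat) (w : seq T) :
  0 < m -> size w = m * b ->
  exists w1 B w2, [/\ w = w1 ++ B ++ w2, size B = b &
    \sum_(x <- w) g x <= m * \sum_(x <- B) g x].
Proof.
elim: m w => // -[|m] IH w _ sw.
  by exists [::], w, [::]; rewrite cats0 mul1n; split=> //; rewrite sw mul1n.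
have sd : size (drop b w) = m.+1 * b by rewrite size_drop sw; lia.
have st : size (take b w) = b by rewrite size_takel // sw; lia.
have [w1 [B [w2 [dE sB le]]]] := IH _ isT sd.
have wE : \sum_(x <- w) g x =
    \sum_(x <- take b w) g x + \sum_(x <- drop b w) g x.
  by rewrite -big_cat cat_take_drop.
case: (leqP (\sum_(x <- B) g x) (\sum_(x <- take b w) g x)) => cmp.
  exists [::], (take b w), (drop b w); rewrite cat_take_drop; split=> //.
  by rewrite wE; nia.
exists (take b w ++ w1), B, w2; rewrite -catA -dE cat_take_drop; split=> //.
by rewrite wE; nia.
Qed.

(** Induction on [k] by Chebyshev's sum inequality for the similarly ordered families [a x] and
    [a x ^ k.+1], obtained by summing [cheb] over all pairs. *)
Lemma power_mean (I : finType) (X : {set I}) (a : I -> nat) (k : nat) :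
  (\sum_(x in X) a x) ^ k.+1 <= #|X| ^ k * \sum_(x in X) a x ^ k.+1.
Proof.
elim: k => [|k IH]; first by rewrite mul1n expn1.
have cheb x y : a x * a y ^ k.+1 + a y * a x ^ k.+1 <=
    a x ^ k.+2 + a y ^ k.+2.
  rewrite !(expnS _ k.+1); case: (leqP (a x) (a y)) => [le|/ltnW le];
  have := leq_exp2r (a x) (a y) (ltn0Sn k);
  have := leq_exp2r (a y) (a x) (ltn0Sn k); rewrite ?le; nia.
have step : (\sum_(x in X) a x) * (\sum_(x in X) a x ^ k.+1) <=
    #|X| * \sum_(x in X) a x ^ k.+2.
  suff : 2 * ((\sum_(x in X) a x) * (\sum_(x in X) a x ^ k.+1)) <=
      2 * (#|X| * \sum_(x in X) a x ^ k.+2) by rewrite leq_pmul2l.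
  have -> : 2 * ((\sum_(x in X) a x) * (\sum_(x in X) a x ^ k.+1)) =
      \sum_(x in X) \sum_(y in X) (a x * a y ^ k.+1 + a y * a x ^ k.+1).
    transitivity (\sum_(x in X) \sum_(y in X) a x * a y ^ k.+1 +
                  \sum_(x in X) \sum_(y in X) a y * a x ^ k.+1).
      rewrite [X in _ = _ + X]exchange_big /= mul2n -addnn big_distrl /=.
      by congr (_ + _); apply: eq_bigr => x _; rewrite big_distrr.
    by rewrite -big_split; apply: eq_bigr => x _; rewrite -big_split.
  have -> : 2 * (#|X| * \sum_(x in X) a x ^ k.+2) =
      \sum_(x in X) \sum_(y in X) (a x ^ k.+2 + a y ^ k.+2).
    under [RHS]eq_bigr => x _ do rewrite big_split /= sum_nat_const.
    by rewrite big_split /= sum_nat_const -big_distrr /= mul2n addnn.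
  by apply: leq_sum => x _; apply: leq_sum => y _; apply: cheb.
rewrite expnS (leq_trans (leq_mul (leqnn _) IH)) //.
by rewrite mulnCA expnSr -mulnA leq_mul.
Qed.

(** * Dependent random choice *)

(** The map [g] is read only on [S], so that tuples indexed by ['I_k] and embeddings of an
    in-neighbourhood share one notion. *)
Definition common_out (W I : finType) (t : rel W) (S : {set I}) (g : I -> W)
    (Y : {set W}) : {set W} :=
  [set y in Y | [forall i in S, t (g i) y]].

Definition bad_maps (W : finType) (t : rel W) (A Y : {set W}) (p k : nat) :
    {set {ffun 'I_k -> W}} :=
  [set g in ffun_on (mem A) | #|common_out t setT g Y| * 2 ^ p < #|Y| ].

Lemma double_count (I J : finType) (P : {pred I}) (Q : {pred J}) (r : I -> J -> bool) :
  \sum_(i in P) #|[set j in Q | r i j]| = \sum_(j in Q) #|[set i in P | r i j]|.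
Proof.
transitivity (\sum_(i in P) \sum_(j in Q | r i j) 1).
  by apply: eq_bigr => i _; rewrite sum1_card; apply: eq_card => j; rewrite !inE.
rewrite (exchange_big_dep (mem Q)) /=; last by move=> i j _ /andP[].
apply: eq_bigr => j jQ; rewrite -sum1_card; apply: eq_bigl => i.
by rewrite !inE jQ.
Qed.

Lemma card_ffun_forall (I W : finType) (Y : {set W}) (r : pred W) :
  #|[set g : {ffun I -> W} in ffun_on (mem Y) | [forall i, r (g i)]]| =
    #|[set y in Y | r y]| ^ #|I|.
Proof.
rewrite -card_ffun_on; apply: eq_card => g; rewrite inE.
apply/andP/ffun_onP => [[/ffun_onP gY /forallP gr] i|gY].
  by rewrite inE gY gr.
split; first by apply/ffun_onP => i; have := gY i; rewrite inE => /andP[].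
by apply/forallP => i; have := gY i; rewrite inE => /andP[].
Qed.

(* [A] is the common in-neighbourhood in [X] of [q] random samples from [Y]. *)
Lemma dependent_random_choice (W : finType) (t : rel W) (X Y : {set W})
    (d q p r : nat) :
    0 < #|X| -> 0 < #|Y| -> 0 < d ->
    #|X| * #|Y| ^ q <= 2 ^ r * \sum_(x in X) #|[set y in Y | t x y]| ^ q ->
  exists A : {set W}, [/\ A \subset X, #|X| <= 2 ^ r.+1 * #|A|
    & forall k, 0 < k <= d ->
        2 ^ (p * q) * #|bad_maps t A Y p k| <= 2 ^ r.+1 * d * #|X| ^ k].
Proof.
move=> X0 Y0 d0 dens.
pose smp : {pred {ffun 'I_q -> W}} := ffun_on (mem Y).
pose A (ys : {ffun 'I_q -> W}) := [set x in X | [forall j, t x (ys j)]].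
have cardsmp : #|smp| = #|Y| ^ q by rewrite card_ffun_on card_ord.
(* Expected size of [A]: [x] survives when all [q] samples are out-neighbours of [x]. *)
have sumA : \sum_(ys in smp) #|A ys| = \sum_(x in X) #|[set y in Y | t x y]| ^ q.
  rewrite (double_count smp (mem X) (fun ys x => [forall j, t x (ys j)])).
  by apply: eq_bigr => x _; rewrite card_ffun_forall card_ord.
(* A tuple lies in [A ys] only if every sample falls in its common out-neighbourhood; for a bad
   tuple this has probability at most [2 ^ -(p * q)]. *)
have sumB k : 2 ^ (p * q) * \sum_(ys in smp) #|bad_maps t (A ys) Y p k|
              <= #|X| ^ k * #|Y| ^ q.
  have -> : \sum_(ys in smp) #|bad_maps t (A ys) Y p k| =
      \sum_(ys in smp) #|[set g in bad_maps t X Y p k |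
                          [forall j, [forall i in setT, t (g i) (ys j)]]]|.
    apply: eq_bigr => ys _; apply: eq_card => g.
    rewrite inE [in RHS]inE [RHS]andbAC [LHS]inE; congr (_ && _).
    apply/ffun_onP/andP => [gA|[/ffun_onP gX /forallP gt] i].
      split; first by apply/ffun_onP => i; have := gA i; rewrite inE => /andP[].
      apply/forallP => j; apply/forallP => i; apply/implyP => _.
      by have := gA i; rewrite inE => /andP[_ /forallP].
    rewrite inE; apply/andP; split; first exact: gX.
    by apply/forallP => j; have /forallP/(_ i) := gt j; rewrite inE.
  rewrite (double_count smp (mem (bad_maps t X Y p k))
    (fun ys (g : {ffun 'I_k -> W}) => [forall j, [forall i in setT, t (g i) (ys j)]])).
  rewrite big_distrr /= (leq_trans (n := \sum_(g in bad_maps t X Y p k) #|Y| ^ q)) //.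
    apply: leq_sum => g; rewrite inE => /andP[_ /ltnW le].
    rewrite (card_ffun_forall _ Y (fun y => [forall i in setT, t (g i) y])).
    rewrite card_ord expnM -expnMn mulnC.
    by case: (q) => // q'; rewrite leq_exp2r // mulnC.
  rewrite sum_nat_const leq_mul2r; apply/orP; right.
  have -> : #|X| ^ k = #|[pred g : {ffun 'I_k -> W} | g \in ffun_on (mem X)]|.
    by rewrite -[in LHS](card_ord k) -card_ffun_on.
  apply: subset_leq_card.
  by apply/subsetP => g; rewrite inE => /andP[].
(* The powers of [#|X|] put tuples of all lengths up to [d] on one scale, so that a single sample
   serves every length. *)
pose G ys := \sum_(k < d) 2 ^ (p * q) * #|bad_maps t (A ys) Y p k.+1| * #|X| ^ (d - k.+1).
have sumG : \sum_(ys in smp) G ys <= d * #|X| ^ d * #|Y| ^ q.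
  rewrite exchange_big /=.
  rewrite (leq_trans (n := \sum_(k < d) #|X| ^ d * #|Y| ^ q)) //; last first.
    by rewrite sum_nat_const card_ord mulnA.
  apply: leq_sum => k _; rewrite -big_distrl -big_distrr /=.
  apply: leq_trans (leq_mul (sumB k.+1) (leqnn _)) _.
  by rewrite mulnAC -expnD subnKC.
(* On average the left side is at most [2 * d * #|X| ^ d] and the right side at least that. Dropping
   [G ys] then bounds [#|A ys|] below; inserting [#|A ys| <= #|X|] bounds [G ys] above. *)
have [ys ysP ysG] : exists2 ys, ys \in smp &
    G ys + d * #|X| ^ d <= 2 * d * #|X| ^ d.-1 * 2 ^ r * #|A ys|.
  apply/exists_inP; apply: contraT; rewrite negb_exists_in => /forall_inP H.
  have : \sum_(ys in smp) (2 * d * #|X| ^ d.-1 * 2 ^ r * #|A ys|).+1 <=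
         \sum_(ys in smp) (G ys + d * #|X| ^ d).
    by apply: leq_sum => ys /H; rewrite -ltnNge.
  under eq_bigr => ys _ do rewrite -addn1.
  rewrite !big_split /= !sum_nat_const cardsmp -big_distrr /= sumA.
  have Yq : 0 < #|Y| ^ q by rewrite expn_gt0 Y0.
  have dE : #|X| ^ d = #|X| * #|X| ^ d.-1 by rewrite -expnS prednK.
  have := leq_mul (leqnn (2 * d * #|X| ^ d.-1)) dens.
  rewrite dE in sumG *.
  move: (\sum_(ys in smp) G ys) (\sum_(x in X) _) (#|Y| ^ q) (#|X| ^ d.-1)
    (2 ^ r) Yq sumG.
  by move=> *; nia.
have X1 j : 0 < #|X| ^ j by rewrite expn_gt0 X0.
have AX : A ys \subset X by apply/subsetP => x; rewrite inE => /andP[].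
have dE : #|X| ^ d = #|X| * #|X| ^ d.-1 by rewrite -expnS prednK.
exists (A ys); split => //.
  have : d * #|X| ^ d.-1 * #|X| <= d * #|X| ^ d.-1 * (2 ^ r.+1 * #|A ys|).
    rewrite expnS; move: ysG; rewrite dE; move: (G ys) => g ysG.
    by apply: leq_trans (leq_addl g _) _; nia.
  by rewrite leq_pmul2l // muln_gt0 d0 X1.
case=> // k /= kd.
have Gk : 2 ^ (p * q) * #|bad_maps t (A ys) Y p k.+1| * #|X| ^ (d - k.+1) <= G ys.
  by rewrite /G (bigD1 (Ordinal kd)) //= leq_addr.
have GX : G ys <= 2 ^ r.+1 * d * #|X| ^ d.
  apply: leq_trans (leq_addr _ _) (leq_trans ysG _).
  rewrite dE expnS; have := subset_leq_card AX; move: #|A ys| (#|X| ^ d.-1) => a x.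
  by nia.
have := leq_trans Gk GX.
have -> : #|X| ^ d = #|X| ^ k.+1 * #|X| ^ (d - k.+1) by rewrite -expnD subnKC.
by rewrite mulnA leq_pmul2r.
Qed.

(** * Choosing distinct representatives that avoid bad tuples *)

Lemma card_bigcup_le (I W : finType) (P : {set I}) (F : I -> {set W}) :
  #|\bigcup_(i in P) F i| <= \sum_(i in P) #|F i|.
Proof.
elim/big_rec2: _ => [|i m B _ le]; first by rewrite cards0.
by apply: leq_trans (leq_card_setU _ _) _; rewrite leq_add2l.
Qed.

Section Counting.
(** In the application [U] is a layer, [U0] its vertices without in-neighbours, [J] the vertices of
    the next layer with in-neighbours, [S v] the in-neighbourhood of [v], and [bad v f] says that
    the image of [S v] has too few common out-neighbours. *)
Variables (T W : finType) (w0 : W) (U U0 J : {set T}) (C : T -> {set W})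
  (S : T -> {set T}) (bad : T -> (T -> W) -> bool) (Delta : nat).
Hypotheses
  (C1 : {in U, forall u, 8 * #|U :\: U0| <= #|C u|})
  (C0 : {in U0, forall u, 16 * #|U0| <= #|C u|})
  (SU : {in J, forall v, S v \subset U})
  (S0 : {in J, forall v, S v != set0})
  (degS : forall u, #|[set v in J | u \in S v]| <= Delta)
  (bad_local : forall v f g, {in S v, f =1 g} -> bad v f = bad v g).

(* Partial maps on [Q], extended by [w0] outside [Q]. *)
Definition choices (Q : {set T}) : {set {ffun T -> W}} :=
  [set f : {ffun T -> W} |
    [forall x, if x \in Q then f x \in C x else f x == w0]].

Hypothesis few_bad : {in J, forall v,
  Delta * 2 ^ #|S v|.+1 * #|[set f in choices (S v) | bad v f]| <=
    \prod_(w in S v) #|C w|}.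

Definition valid (Q : {set T}) : {set {ffun T -> W}} :=
  [set f in choices Q | dinjectiveb f Q
     && [forall v in J, (S v \subset Q) ==> ~~ bad v f]].

Definition restr (Q : {set T}) (f : {ffun T -> W}) : {ffun T -> W} :=
  [ffun x => if x \in Q then f x else w0].

Lemma choicesP (Q : {set T}) (f : {ffun T -> W}) :
  reflect ({in Q, forall x, f x \in C x} /\ {in ~: Q, forall x, f x = w0})
          (f \in choices Q).
Proof.
rewrite inE; apply: (iffP forallP) => [H|[H1 H2] x].
  split=> x xQ; have := H x; first by rewrite xQ.
  by rewrite inE in xQ; rewrite (negPf xQ) => /eqP.
by case: ifPn => xQ; [apply: H1|apply/eqP/H2; rewrite inE].
Qed.

Lemma restr_choices (Q R : {set T}) f :
  R \subset Q -> f \in choices Q -> restr R f \in choices R.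
Proof.
move=> /subsetP RQ /choicesP[fC _]; apply/choicesP; split=> x; rewrite ffunE.
  by move=> xR; rewrite xR; apply/fC/RQ.
by rewrite inE => /negPf->.
Qed.

Lemma restr_valid (Q R : {set T}) f :
  R \subset Q -> f \in valid Q -> restr R f \in valid R.
Proof.
move=> RQ; rewrite inE => /and3P[fQ /dinjectiveP fi /forall_inP fb].
have rE : {in R, restr R f =1 f} by move=> x xR; rewrite ffunE xR.
rewrite inE; apply/and3P; split; first exact: restr_choices fQ.
  apply/dinjectiveP => x y xR yR; rewrite !rE //; apply: fi;
  exact: (subsetP RQ).
apply/forall_inP => v vJ; apply/implyP => SR.
rewrite (@bad_local v _ f); first exact: (implyP (fb v vJ)) (subset_trans SR RQ).
by move=> x /(subsetP SR)/rE.
Qed.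

Lemma restr_in (Q : {set T}) f x : x \in Q -> restr Q f x = f x.
Proof. by move=> xQ; rewrite ffunE xQ. Qed.

Lemma restr_restr (Q R : {set T}) f : R \subset Q -> restr R (restr Q f) = restr R f.
Proof.
move=> /subsetP RQ; apply/ffunP => x; rewrite !ffunE.
by case: ifP => // /RQ->.
Qed.

Let N Q := #|valid Q|.

(** Putting the vertices [w] of [R] back one at a time multiplies the number of valid maps by at
    least [#|C w| / 2] each. Growth is assumed only for sets smaller than [Q], so this can be used
    inside the induction proving growth. *)
Lemma valid_shrink (Q R : {set T}) :
    (forall (Q' : {set T}) u, #|Q'| < #|Q| -> Q' \subset U -> u \in U :\: Q' ->
       #|C u| * N Q' <= 2 * N (u |: Q')) ->
    Q \subset U -> R \subset Q ->
  N (Q :\: R) * \prod_(w in R) #|C w| <= 2 ^ #|R| * N Q.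
Proof.
move=> grow QU; move: {2}#|R| (erefl #|R|) => n; elim: n R => [|n IH] R nR RQ.
  by rewrite nR (cards0_eq nR) big_set0 setD0 muln1 mul1n.
have /card_gt0P[w wR] : 0 < #|R| by rewrite nR.
have wQ : w \in Q by apply: (subsetP RQ).
have nR' : #|R :\ w| = n by move: nR; rewrite (cardsD1 w) wR => -[].
have RQ' : R :\ w \subset Q by apply: subset_trans RQ; apply: subD1set.
have := IH _ nR' RQ'.
have QE : Q :\: (R :\ w) = w |: (Q :\: R).
  by apply/setP => x; rewrite !inE; case: eqVneq => [->|]; rewrite ?wR ?wQ.
have lt : #|Q :\: R| < #|Q|.
  apply: proper_card; apply/properP; split; first exact: subsetDl.
  by exists w => //; rewrite inE wR.
have wU : w \in U :\: (Q :\: R) by rewrite !inE wR (subsetP QU).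
have := grow _ _ lt (subset_trans (subsetDl _ _) QU) wU.
rewrite QE (big_setD1 w wR) nR nR' /= expnS.
move: (\prod_(i in R :\ w) _) (N (Q :\: R)) (N (w |: _)) (N Q) => x a b c; clear; nia.
Qed.

(* Rosenfeld's counting argument, which plays the role of the local lemma. *)
Lemma valid_grow (Q : {set T}) u :
  Q \subset U -> u \in U :\: Q -> #|C u| * N Q <= 2 * N (u |: Q).
Proof.
move: {2}#|Q|.+1 (ltnSn #|Q|) => n; elim: n Q u => // n IHn Q u ltn QU.
rewrite inE => /andP[uQ uU].
have shrink : forall R : {set T}, R \subset Q ->
    N (Q :\: R) * \prod_(w in R) #|C w| <= 2 ^ #|R| * N Q.
  move=> R; apply: valid_shrink => // Q' u' lt; apply: IHn.
  by apply: leq_trans lt _; rewrite -ltnS.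
pose Q1 := u |: Q.
have QQ1 : Q \subset Q1 by apply: subsetUr.
have uQ1 : u \in Q1 by rewrite setU11.
(* One of these [#|C u| * N Q] extensions fails to be valid only if it repeats a value at [u] or
   makes some [v] with [u] in [S v] bad. Repetitions with [U0], other repetitions and bad tuples
   spoil at most 1/8, 1/8 and 1/4 of [E]. *)
pose E := [set f in choices Q1 | restr Q f \in valid Q].
have cardE : #|E| = #|C u| * N Q.
  pose ext (p : W * {ffun T -> W}) : {ffun T -> W} :=
    [ffun x => if x == u then p.1 else p.2 x].
  have eE c g : g \in valid Q -> restr Q (ext (c, g)) = g.
    rewrite inE => /and3P[/choicesP[_ pw] _ _].
    apply/ffunP => x; rewrite !ffunE; case: ifPn => [xQ|xQ].
      by case: eqVneq => // xu; rewrite -xu xQ in uQ.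
    by rewrite pw // inE.
  rewrite -cardsX -(card_in_imset (f := ext)); last first.
    move=> [c g] [c' g'] /setXP[_ gv] /setXP[_ gv'] e; congr (_, _).
      by have /ffunP/(_ u) := e; rewrite !ffunE eqxx.
    by rewrite -(eE c g gv) -(eE c' g' gv') e.
  apply: eq_card => f; apply/idP/imsetP => [|[[c g] /setXP[cC gv] ->]].
    rewrite inE => /andP[/choicesP[fC fw] fv]; exists (f u, restr Q f).
      by rewrite inE fv andbT; apply: fC.
    apply/ffunP => x; rewrite !ffunE /=; case: eqVneq => [->//|xu].
    by case: ifPn => // xQ; apply: fw; rewrite !inE negb_or xu.
  rewrite inE eE // gv andbT.
  have := gv; rewrite inE => /and3P[/choicesP[pQ pw] _ _].
  apply/choicesP; split=> x; rewrite !inE ffunE; first by case: eqVneq => [->|_ /pQ].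
  by rewrite negb_or => /andP[/negPf-> xQ]; apply: pw; rewrite inE.
pose coll w := [set f in E | f u == f w].
pose badE v := [set f in E | bad v f].
pose Ju := [set v in J | (u \in S v) && (S v \subset Q1)].
pose CC := \bigcup_(w in Q) coll w.
pose BB := \bigcup_(v in Ju) badE v.
have sub : E \subset valid Q1 :|: CC :|: BB.
  apply/subsetP => f fE; rewrite !in_setU -orbA.
  have := fE; rewrite inE => /andP[fC].
  rewrite inE => /and3P[_ /dinjectiveP fi /forall_inP fb].
  case: (boolP (f \in CC)) => [fc|/bigcupP ncoll]; first by apply/or3P; constructor 2.
  case: (boolP (f \in BB)) => [fc|/bigcupP nbad]; first by apply/or3P; constructor 3.
  apply/or3P; constructor 1; rewrite inE; apply/and3P; split=> //.
    have fiQ x y : x \in Q -> y \in Q -> f x = f y -> x = y.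
      by move=> xQ yQ e; apply: fi; rewrite ?restr_in.
    apply/dinjectiveP => x y; rewrite !inE => /predU1P[->|xQ] /predU1P[->|yQ] e //.
    - by case: ncoll; exists y; rewrite // inE fE e /=.
    - by case: ncoll; exists x; rewrite // inE fE e /=.
    - exact: fiQ.
  apply/forall_inP => v vJ; apply/implyP => SQ1.
  case: (boolP (u \in S v)) => uS.
    by apply/negP => b; case: nbad; exists v; rewrite inE ?vJ ?uS ?fE.
  have SQ : S v \subset Q.
    apply/subsetP => x xS; have := subsetP SQ1 x xS; rewrite !inE.
    by case/predU1P => // xu; rewrite -xu xS in uS.
  rewrite (@bad_local v _ (restr Q f)); first exact: (implyP (fb v vJ)).
  by move=> x xS; rewrite restr_in // (subsetP SQ).
have EQ f : f \in E -> restr Q f \in valid Q by rewrite inE => /andP[].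
have EC f x : f \in E -> x \in Q1 -> f x \in C x.
  by rewrite inE => /andP[/choicesP[fC _] _]; apply: fC.
have Ew f x : f \in E -> x \notin Q1 -> f x = w0.
  by rewrite inE => /andP[/choicesP[_ fw] _] xQ; apply: fw; rewrite inE.
have collP w f : f \in coll w -> f \in E /\ f u = f w.
  by rewrite inE => /andP[? /eqP].
have badEP v f : f \in badE v -> f \in E /\ bad v f.
  by rewrite inE => /andP[].
(* The value at [u] is forced by the value at [w]. *)
have coll1 w : w \in Q -> #|coll w| <= N Q.
  move=> wQ; rewrite -(card_in_imset (f := restr Q)).
    apply: subset_leq_card; apply/subsetP => _ /imsetP[f fc ->].
    by apply: EQ; case: (collP _ _ fc).
  move=> f g /collP[fE fu] /collP[gE gu] /ffunP e.
  have eQ x : x \in Q -> f x = g x by move=> xQ; have := e x; rewrite !restr_in.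
  apply/ffunP => x; case: (boolP (x \in Q1)) => [|xQ]; last by rewrite !Ew.
  by rewrite !inE => /predU1P[->|/eQ//]; rewrite fu gu eQ.
(* For [w] in [U0], where [#|C u|] may be small against [#|U0|], the value at [w] is forgotten
   instead: it is recovered from [f u], and [shrink] gains a factor [#|C w| / 2]. *)
have coll0 w : w \in Q -> #|C w| * #|coll w| <= 2 * (#|C u| * N Q).
  move=> wQ.
  have le : #|coll w| <= #|C u| * N (Q :\ w).
    rewrite -cardsX -(card_in_imset
      (f := fun f : {ffun T -> W} => (f u, restr (Q :\ w) f))).
      apply: subset_leq_card; apply/subsetP => _ /imsetP[f fc ->].
      have [fE _] := collP _ _ fc; rewrite in_setX /=; apply/andP; split.
        exact: (EC f u fE uQ1).
      rewrite -(restr_restr _ (subD1set Q w)).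
      exact: restr_valid (subD1set Q w) (EQ _ fE).
    move=> f g /collP[fE fu] /collP[gE gu] [eu /ffunP e].
    apply/ffunP => x; case: (boolP (x \in Q1)) => [|xQ]; last by rewrite !Ew.
    rewrite !inE => /predU1P[->//|xQ]; case: (eqVneq x w) => [->|xw].
      by rewrite -fu -gu.
    by have := e x; rewrite !restr_in // !inE xw.
  have w1 : [set w] \subset Q by rewrite sub1set.
  have := shrink _ w1; rewrite big_set1 cards1 expn1.
  move: (N Q) (N (Q :\ w)) #|C w| #|C u| #|coll w| le; clear.
  by move=> x y a b c le; have := leq_mul (leqnn a) le; nia.
(* A map in [badE v] is determined by its restrictions to [Q :\: R] and [S v]. Deleting [R], of size
   [#|S v| - 1], costs [2 ^ #|R|], and [few_bad] provides this factor times 4. *)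
have bad1 v : v \in Ju -> 4 * Delta * #|badE v| <= #|C u| * N Q.
  rewrite inE => /and3P[vJ uS SQ1].
  pose R := S v :\ u.
  have RQ : R \subset Q.
    apply/subsetP => x; rewrite !inE => /andP[xu /(subsetP SQ1)].
    by rewrite !inE (negPf xu).
  have le : #|badE v| <= N (Q :\: R) * #|[set f in choices (S v) | bad v f]|.
    rewrite -cardsX -(card_in_imset
      (f := fun f : {ffun T -> W} => (restr (Q :\: R) f, restr (S v) f))).
      apply: subset_leq_card; apply/subsetP => _ /imsetP[f fc ->].
      have [fE fb] := badEP _ _ fc; rewrite in_setX /=; apply/andP; split.
        rewrite -(restr_restr _ (subsetDl Q R)).
        exact: restr_valid (subsetDl Q R) (EQ _ fE).
      rewrite inE; apply/andP; split.
        by apply: (restr_choices SQ1); move: fE; rewrite inE => /andP[].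
      by rewrite (@bad_local v _ f) // => x xS; rewrite restr_in.
    move=> f g /badEP[fE _] /badEP[gE _] [/ffunP e1 /ffunP e2].
    apply/ffunP => x; case: (boolP (x \in Q1)) => [xQ|xQ]; last by rewrite !Ew.
    case: (boolP (x \in S v)) => xS; first by have := e2 x; rewrite !restr_in.
    have xu : x != u by apply: contraNneq xS => ->.
    have xQR : x \in Q :\: R.
      by move: xQ; rewrite in_setD in_setD1 (negPf xS) andbF in_setU1 (negPf xu).
    by have := e1 x; rewrite !restr_in.
  have := shrink _ RQ; have := few_bad vJ.
  have cS : #|S v| = #|R|.+1 by rewrite (cardsD1 u) uS.
  rewrite cS (big_setD1 u uS) /= -/R !expnS.
  move: le; set b := #|[set f in choices (S v) | bad v f]|.
  case: (posnP b) => [-> le _ _|b0].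
    by move: le; rewrite muln0 leqn0 => /eqP->; rewrite muln0.
  have : 0 < 2 ^ #|R| by rewrite expn_gt0.
  move: (\prod_(i in R) _) (N (Q :\: R)) (N Q) #|badE v| #|C u| (2 ^ #|R|).
  move=> P nR nq e c p p0 le few sh.
  have pb : 0 < p * b by rewrite muln_gt0 p0.
  rewrite -(leq_pmul2r pb).
  have h1 : e * (Delta * (2 * (2 * p)) * b) <= e * (c * P) by rewrite leq_mul2l few orbT.
  have h2 : e * (c * P) <= nR * b * (c * P) by rewrite leq_mul2r le orbT.
  have h3 : b * c * (nR * P) <= b * c * (p * nq) by rewrite leq_mul2l sh orbT.
  move: h1 h2 h3; clear; lia.
have sumE : #|E| <= N Q1 + \sum_(w in Q) #|coll w| + \sum_(v in Ju) #|badE v|.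
  apply: leq_trans (subset_leq_card sub) _.
  apply: leq_trans (leq_card_setU _ _) _; apply: leq_add.
    apply: leq_trans (leq_card_setU _ _) _; rewrite leq_add2l.
    exact: card_bigcup_le.
  exact: card_bigcup_le.
have s0 : 8 * \sum_(w in Q :&: U0) #|coll w| <= #|C u| * N Q.
  case: (posnP #|U0|) => [/cards0_eq ->|U0p]; first by rewrite setI0 big_set0 muln0.
  rewrite -(leq_pmul2l U0p) big_distrr big_distrr /=.
  apply: (@leq_trans (\sum_(w in Q :&: U0) #|C u| * N Q)).
    apply: leq_sum => w; rewrite inE => /andP[wQ wU0].
    have := coll0 w wQ; have := leq_mul (C0 wU0) (leqnn #|coll w|).
    move: (#|C u| * N Q) (#|coll w|) (#|C w|) #|U0| => x y z k; clear; nia.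
  by rewrite sum_nat_const leq_mul2r subset_leq_card ?orbT // subsetIr.
have s1 : 8 * \sum_(w in Q :\: U0) #|coll w| <= #|C u| * N Q.
  apply: (@leq_trans (8 * (#|U :\: U0| * N Q))); last first.
    by rewrite mulnA leq_mul2r C1 // orbT.
  rewrite leq_mul2l /=; apply: (@leq_trans (\sum_(w in Q :\: U0) N Q)).
    by apply: leq_sum => w; rewrite inE => /andP[_]; apply: coll1.
  by rewrite sum_nat_const leq_mul2r subset_leq_card ?orbT // setSD.
have s2 : 4 * \sum_(v in Ju) #|badE v| <= #|C u| * N Q.
  have JuD : #|Ju| <= Delta.
    apply: leq_trans (degS u); apply: subset_leq_card.
    by apply/subsetP => v; rewrite !inE => /and3P[-> ->].
  case: (posnP Delta) => [D0|Dp].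
    have /cards0_eq -> : #|Ju| = 0 by apply/eqP; rewrite -leqn0 -D0.
    by rewrite big_set0 muln0.
  rewrite -(leq_pmul2l Dp) big_distrr big_distrr /=.
  apply: (@leq_trans (\sum_(v in Ju) #|C u| * N Q)).
    by apply: leq_sum => v vJ; rewrite mulnA (mulnC Delta); apply: bad1.
  by rewrite sum_nat_const leq_mul2r JuD orbT.
move: sumE; rewrite cardE (big_setID U0) /= -/Q1.
move: (#|C u| * N Q) (N Q1) (\sum_(w in Q :&: U0) _) (\sum_(w in Q :\: U0) _)
  (\sum_(v in Ju) _) s0 s1 s2; clear; lia.
Qed.

(** The empty map is valid because no [S v] is empty, and [valid_grow] keeps the number of valid
    maps positive since the candidate sets are nonempty. *)
Lemma valid_exists : exists f : T -> W,
  [/\ {in U, forall u, f u \in C u}, {in U &, injective f}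
    & {in J, forall v, ~~ bad v f}].
Proof.
have pos n : forall Q : {set T}, #|Q| = n -> Q \subset U -> 0 < N Q.
  elim: n => [|n IH] Q nQ QU.
    apply/card_gt0P; exists [ffun=> w0]; rewrite (cards0_eq nQ) inE.
    apply/and3P; split.
    - by apply/choicesP; split=> x; rewrite ?inE // ffunE.
    - by apply/dinjectiveP => x; rewrite inE.
    - by apply/forall_inP => v vJ; rewrite subset0 (negPf (S0 vJ)).
  have /card_gt0P[u uQ] : 0 < #|Q| by rewrite nQ.
  have uU := subsetP QU u uQ.
  have nQ' : #|Q :\ u| = n by move: nQ; rewrite (cardsD1 u) uQ => -[].
  have QU' : Q :\ u \subset U by apply: subset_trans QU; apply: subD1set.
  have uUQ : u \in U :\: (Q :\ u) by rewrite !inE eqxx.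
  have := valid_grow QU' uUQ; rewrite setD1K //.
  suff Cu : 0 < #|C u| by move: (IH _ nQ' QU') Cu; clear; nia.
  case: (boolP (u \in U0)) => uU0.
    by apply: leq_trans (C0 uU0); rewrite muln_gt0; apply/card_gt0P; exists u.
  apply: leq_trans (C1 uU); rewrite muln_gt0; apply/card_gt0P; exists u.
  by rewrite inE uU0.
have /card_gt0P[f] := pos _ U (erefl _) (subxx _).
rewrite inE => /and3P[/choicesP[fC _] /dinjectiveP fi /forall_inP fb].
by exists f; split=> // v vJ; apply: (implyP (fb v vJ)); apply: SU.
Qed.

End Counting.

(** * Exponents and block sizes *)

(** Bernoulli's inequality for [1 - 1/x], cleared of denominators. *)
Lemma bernoulli x b : b <= x -> x ^ b * (x - b) <= x * x.-1 ^ b.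
Proof.
elim: b => [|b IH] bx; first by rewrite subn0 mul1n muln1.
have {IH} := leq_mul (leqnn x.-1) (IH (ltnW bx)).
have : x * (x - b.+1) <= x.-1 * (x - b) by nia.
rewrite !expnS => /(leq_mul (leqnn (x ^ b))).
move: (x ^ b) (x.-1 ^ b) => u v; nia.
Qed.

(** The ratio of the bases is [1 - 1/(4 * D)], and [D] factors of it lose at most a factor 2 by
    Bernoulli's inequality. A density [1/2 - 1/(8 * D)] thus costs little more than [1/2] in a
    [q]-th power. *)
Lemma expn_pred_ratio D q :
  0 < D -> (8 * D) ^ q <= 2 ^ (q %/ D).+1 * (8 * D - 2) ^ q.
Proof.
move=> D0.
have small b : b <= D -> (4 * D) ^ b <= 2 * (4 * D).-1 ^ b.
  move=> bD; have bx : b <= 4 * D by lia.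
  have := bernoulli bx; move: ((4 * D) ^ b) ((4 * D).-1 ^ b) => u v; nia.
have -> : 8 * D - 2 = 2 * (4 * D).-1 by lia.
have -> : 8 * D = 2 * (4 * D) by lia.
move: (4 * D) small => x small.
rewrite !expnMn [X in _ <= X]mulnCA leq_mul2l; apply/orP; right.
suff H a b : b <= D -> x ^ (a * D + b) <= 2 ^ a.+1 * x.-1 ^ (a * D + b).
  by have := H (q %/ D) (q %% D) (ltnW (ltn_pmod q D0)); rewrite -divn_eq.
move=> /small sb; elim: a => [|a IH]; first by rewrite mul0n.
rewrite mulSn -addnA !(expnD _ D) expnS mulnACA.
exact: leq_mul (small D (leqnn D)) IH.
Qed.

Section Weights.
Variables (T : finType) (D : rel T) (lev : T -> nat).
Hypotheses (lev_edge : forall x y, D x y -> lev y = (lev x).+1)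
  (edgeD : exists x y, D x y).

Definition layer_in (i : nat) : nat := \max_(v | lev v == i.+1) in_degree D v.
Definition layer (i : nat) : {set T} := [set v | lev v == i].
Definition sources (i : nat) : {set T} := [set v in layer i | in_degree D v == 0].

Local Notation d := layer_in.
Local Notation Din := (max_in_degree D).
Local Notation Dout := (max_out_degree D).

(* Levels start at 1, so that [d 0 = 0] and the truncated predecessors below
   agree with the convention that [d] vanishes at negative indices. *)
Definition codegree_exp (i : nat) : nat := d i + minn (d i) (d i.-1) + 16.
Definition samples (i : nat) : nat :=
  maxn (maxn (2 * d i) (d i.-1 + minn (d i.-1) (d i.-2))) (uphalf (up_log 2 Dout)).
(* The summand [samples i %/ Din + 2] accounts for the edge density being only
   [1/2 - 1/m] with [m = 8 * Din], and for losses in averaging. *)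
Definition density_exp (i : nat) : nat := samples i + samples i %/ Din + 2.
Definition layer_weight (i : nat) : nat :=
  Dout * 2 ^ (2 * (d i.-1 + d i)) * #|layer i|.
Definition block_size (i : nat) : nat :=
  2 ^ 24 * (layer_weight i + layer_weight i.-1).
(** The size that [A_i] needs for the counting argument: a candidate set may be only a fraction
    [2 ^ -(codegree_exp i.-1)] of it, but a vertex without in-neighbours may use all of it. *)
Definition room (i : nat) : nat :=
  16 * (2 ^ codegree_exp i.-1 * #|layer i :\: sources i| + #|sources i|).

Lemma in_degree_le_max v : in_degree D v <= Din.
Proof. exact: (leq_bigmax v). Qed.

Lemma out_degree_le_max v : out_degree D v <= Dout.
Proof. exact: (leq_bigmax v). Qed.

Lemma max_in_degree_gt0 : 0 < Din.
Proof.
have [x [y xy]] := edgeD; apply: leq_trans (in_degree_le_max y).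
by apply/card_gt0P; exists x; rewrite inE.
Qed.

Lemma max_out_degree_gt0 : 0 < Dout.
Proof.
have [x [y xy]] := edgeD; apply: leq_trans (out_degree_le_max x).
by apply/card_gt0P; exists y; rewrite inE.
Qed.

Lemma layer_in_le i : d i <= Din.
Proof. by apply/bigmax_leqP => v _; apply: in_degree_le_max. Qed.

Lemma in_degree_le_layer i v : v \in layer i.+1 -> in_degree D v <= d i.
Proof. by rewrite inE => vi; apply: (leq_bigmax_cond (F := in_degree D)). Qed.

Lemma card_layer i : #|layer i| = #|layer i :\: sources i| + #|sources i|.
Proof.
rewrite (cardsD (layer i)) (setIidPr _) ?subnK ?subset_leq_card //;
by apply/subsetP => v; rewrite inE => /andP[].
Qed.

Lemma nonsources_le i : 0 < i -> #|layer i :\: sources i| <= Dout * #|layer i.-1|.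
Proof.
case: i => // i _ /=.
have sub : layer i.+1 :\: sources i.+1 \subset
    \bigcup_(u in layer i) [set v | D u v].
  apply/subsetP => v; rewrite !inE => /andP[vs vl]; move: vs; rewrite vl /= => vs.
  have /card_gt0P[u] : 0 < in_degree D v by rewrite lt0n.
  rewrite inE => uv; apply/bigcupP; exists u; last by rewrite inE.
  by rewrite inE -eqSS -(lev_edge uv).
apply: leq_trans (subset_leq_card sub) _.
apply: leq_trans (card_bigcup_le _ _) _.
rewrite mulnC -sum_nat_const; apply: leq_sum => u _; exact: out_degree_le_max.
Qed.

Lemma up_log_out_degree : Dout <= 2 ^ up_log 2 Dout /\ 2 ^ up_log 2 Dout <= 2 * Dout.
Proof.
split; first exact: up_logP.
case: (ltnP 1 Dout) => D1; last first.
  have -> : Dout = 1 by have := max_out_degree_gt0; lia.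
  by rewrite up_log1.
have /(up_log_bounds (isT : 1 < 2))/andP[lt _] := D1.
have : 0 < up_log 2 Dout by rewrite up_log_gt0.
by case: up_log lt => //= k; rewrite expnS => /ltnW; rewrite leq_pmul2l.
Qed.

Lemma half_log_le : 2 ^ (2 * uphalf (up_log 2 Dout)) <= 4 * Dout.
Proof.
have [_ hi] := up_log_out_degree.
have : 2 * uphalf (up_log 2 Dout) <= (up_log 2 Dout).+1 by lia.
move/(leq_pexp2l (ltn0Sn 1))/leq_trans; apply; rewrite expnS; lia.
Qed.

(** Case analysis on the term attaining the maximum in [samples i]. The exponent 24 is 4 for the
    factor 16 in [room], 16 from [codegree_exp], and 4 from [density_exp] when
    [samples i <= 2 * Din]. *)
Lemma room_le i : 0 < i -> room i * 2 ^ density_exp i <= block_size i.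
Proof.
move=> i0; rewrite /room /block_size /layer_weight /codegree_exp.
rewrite [#|layer i|]card_layer.
have n1_le := nonsources_le i0.
have D0 := max_in_degree_gt0; have O0 := max_out_degree_gt0.
have ei := layer_in_le i; have ai := layer_in_le i.-1.
move: #|layer i :\: sources i| #|sources i| #|layer i.-1| n1_le => n1 n0 n n1_le.
have pw x y : x <= y -> 2 ^ x <= 2 ^ y by move=> ?; rewrite leq_pexp2l.
have two x : 0 < 2 ^ x by rewrite expn_gt0.
set a := d i.-1 in ai *; set e := d i in ei *; set g := d i.-2.
set m := minn a g.
have ma : m <= a by apply: geq_minl.
have mg : m <= g by apply: geq_minr.
have spread x z : x <= 24 + 2 * (a + e) ->
   2 ^ x * z <= 2 ^ 24 * (Dout * 2 ^ (2 * (a + e)) * z).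
  move=> /pw; rewrite expnD => le; rewrite !mulnA leq_mul2r; apply/orP; right.
  by rewrite mulnAC (leq_trans le) // leq_pmulr.
have pw4 : 2 ^ 4 = 16 by [].
have dens_small : samples i <= 2 * Din -> density_exp i <= samples i + 4.
  move=> le; have : samples i %/ Din <= 2 by rewrite -(mulnK 2 D0) leq_div2r.
  rewrite /density_exp; lia.
have := erefl (samples i); rewrite {2}/samples -/e -/a -/g -/m.
(* When the logarithm dominates, the sampling loss is at most [16 * Dout], absorbed by the factor
   [Dout] in the weight of level [i]. *)
case: (leqP (maxn (2 * e) (a + m)) (uphalf (up_log 2 Dout))) => [_|_] qE.
  have dens : density_exp i <= 2 * uphalf (up_log 2 Dout) + 2.
    rewrite /density_exp qE; have := leq_div (uphalf (up_log 2 Dout)) Din; lia.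
  have {dens} := pw _ _ dens; rewrite expnD; have := half_log_le.
  have h1 : 2 ^ (a + m + 16) <= 2 ^ 16 * 2 ^ (2 * (a + e)).
    rewrite -expnD pw; lia.
  have h0 : 1 <= 2 ^ 16 * 2 ^ (2 * (a + e)) by rewrite muln_gt0 !two.
  have sum1 : 2 ^ (a + m + 16) * n1 + n0 <= 2 ^ 16 * 2 ^ (2 * (a + e)) * (n1 + n0).
    by rewrite mulnDr leq_add ?leq_mul2r ?h1 ?orbT // leq_pmull.
  move=> q1 q2.
  have q3 : 2 ^ density_exp i <= 16 * Dout by apply: leq_trans q2 _; lia.
  apply: leq_trans (leq_mul (leq_mul (leqnn 16) sum1) q3) _.
  have -> : 2 ^ 24 = 16 * 2 ^ 16 * 16 by rewrite -pw4 -!expnD.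
  move: (2 ^ 16) (2 ^ (2 * (a + e))) => x y.
  apply: (@leq_trans (16 * x * 16 * (Dout * y * (n1 + n0)))).
    by apply: eq_leq; lia.
  by rewrite leq_mul2l leq_addr orbT.
have split x : 16 * (2 ^ (a + m + 16) * n1 + n0) * 2 ^ x =
    2 ^ (4 + (a + m + 16) + x) * n1 + 2 ^ (4 + x) * n0.
  by rewrite -pw4 !expnD; lia.
(* When [a + m] dominates, the vertices with in-neighbours are charged to level [i.-1], whose weight
   has exponent [2 * (g + a)], by [n1 <= Dout * n]. *)
case: (leqP (2 * e) (a + m)) qE => [_|_] qE.
  have dens : density_exp i <= a + m + 4.
    by rewrite -qE; apply: dens_small; rewrite qE; lia.
  apply: leq_trans (leq_mul (leqnn _) (pw _ _ dens)) _.
  rewrite split addnC mulnDr; apply: leq_add.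
    apply: leq_trans (spread (4 + (a + m + 4)) n0 _) _; first lia.
    by rewrite leq_mul2l leq_mul2l leq_addl !orbT.
  rewrite -[X in _ <= 2 ^ 24 * X]mulnA (mulnCA Dout) mulnA -expnD.
  by apply: leq_mul => //; apply: pw; lia.
have dens : density_exp i <= 2 * e + 4.
  by rewrite -qE; apply: dens_small; rewrite qE; lia.
apply: leq_trans (leq_mul (leqnn _) (pw _ _ dens)) _.
rewrite split mulnDr -[X in X <= _]addn0 leq_add // mulnDr mulnDr.
by apply: leq_add; apply: spread; lia.
Qed.

(** Dependent random choice thus leaves few enough bad tuples for the counting argument. In base-2
    exponents, [d i * samples i] pays for the main density loss of [k] vertices, [main] for their
    codegree loss, and the summand 16 of [codegree_exp i] for the rest. *)
Lemma exponents_ok i k : 0 < k <= d i ->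
  Dout * 2 ^ ((codegree_exp i.-1).+1 * k).+1 *
    (2 ^ density_exp i * d i * 2 ^ (density_exp i * k)) <=
  2 ^ (codegree_exp i * samples i).
Proof.
case/andP => k0 ke.
have [lo _] := up_log_out_degree.
have e2 : d i <= 2 ^ (d i).-1.
  case: (d i) (leq_trans k0 ke) => //= e _; exact: ltn_expl.
have D0 := max_in_degree_gt0.
apply: leq_trans (leq_mul (leq_mul lo (leqnn _))
  (leq_mul (leq_mul (leqnn _) e2) (leqnn _))) _.
rewrite -!expnD leq_exp2l //.
have := layer_in_le i; rewrite /density_exp /codegree_exp.
set e := d i in ke *; set a := d i.-1; set g := d i.-2; set q := samples i.
set r := q %/ Din => eD.
have rq : r * Din <= q by apply: leq_trunc_div.
have q1 : 2 * e <= q by rewrite /q /samples !leq_max leqnn.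
have q2 : a + minn a g <= q by rewrite /q /samples !leq_max leqnn orbT.
have q3 : uphalf (up_log 2 Dout) <= q by rewrite /q /samples !leq_max leqnn orbT.
(* If [e <= a], the second term of [samples] suffices; otherwise [minn a g <= a] and [2 * e <= q]
   do. So [codegree_exp i] needs only [minn (d i) (d i.-1)] beyond [d i] and a constant. *)
have main : (a + minn a g) * e <= minn e a * q.
  case: (leqP e a) => ea; first by rewrite mulnC leq_mul.
  have := geq_minl a g; move: (minn a g) => m ma; nia.
have re : r * e <= q by apply: leq_trans rq; rewrite leq_mul2l eD orbT.
have rq' : r <= q by apply: leq_div.
have ke1 : (a + minn a g + 16).+1 * k <= (a + minn a g + 16).+1 * e.
  by rewrite leq_mul2l ke orbT.
have ke2 : (q + r + 2) * k <= (q + r + 2) * e by rewrite leq_mul2l ke orbT.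
have lq : up_log 2 Dout <= 2 * q by lia.
have e0 : 0 < e by apply: leq_trans ke.
move: (minn a g) (minn e a) (up_log 2 Dout) main ke1 ke2 lq => m' m l main ke1 ke2 lq.
have : (a + m' + 16).+1 * e = (a + m') * e + 17 * e by lia.
have : (q + r + 2) * e = q * e + r * e + 2 * e by lia.
have : (e + m + 16) * q = q * e + m * q + 16 * q by lia.
lia.
Qed.

End Weights.

(** * Embedding the layers *)

Section Embedding.
Variables (T : finType) (D : rel T) (lev : T -> nat) (h : nat).
Hypotheses (lev_edge : forall x y, D x y -> lev y = (lev x).+1)
  (lev_bounds : forall x, 0 < lev x <= h).
Variables (W : finType) (t : rel W) (w0 : W).

Local Notation d := (layer_in D lev).
Local Notation Dout := (max_out_degree D).
Local Notation layer := (layer lev).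
Local Notation sources := (sources D lev).
Local Notation codegree_exp := (codegree_exp D lev).
Local Notation room := (room D lev).

(* All candidate sets [C] are quantified over because those of layer [i] are
   known only once layer [i - 1] is embedded. *)
Definition extendable (i : nat) (A R : {set W}) : Prop :=
  forall C : T -> {set W},
    (forall u, u \in layer i ->
       [/\ C u \subset A, in_degree D u = 0 -> C u = A
         & #|A| <= #|C u| * 2 ^ codegree_exp i.-1]) ->
  exists f : T -> W,
    [/\ forall u, lev u = i -> f u \in C u,
        forall u, i < lev u -> f u \in R,
        {in [pred u | i <= lev u] &, injective f}
      & forall u v, i <= lev u -> D u v -> t (f u) (f v)].

Lemma extendable_top R : extendable h.+1 set0 R.
Proof.
move=> C _; have ltF u : (h < lev u) = false.
  by have /andP[_] := lev_bounds u; rewrite leqNgt => /negPf.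
exists (fun=> w0); split=> [u ul|u|u v|u v].
- by have := ltF u; rewrite ul ltnSn.
- by move=> /ltnW; rewrite ltF.
- by rewrite inE ltF.
- by rewrite ltF.
Qed.

(** Enumerating [S] turns maps into tuples, injectively because choices are constant outside [S]. *)
Lemma choices_bad_le (S : {set T}) (C : T -> {set W}) (A Y : {set W}) p :
  {in S, forall u, C u \subset A} ->
  #|[set f in choices w0 C S | #|common_out t S f Y| * 2 ^ p < #|Y| ]| <=
    #|bad_maps t A Y p #|S| |.
Proof.
move=> CA; pose g (f : {ffun T -> W}) : {ffun 'I_#|S| -> W} :=
  [ffun j => f (enum_val j)].
rewrite -(card_in_imset (f := g)).
  apply: subset_leq_card; apply/subsetP => _ /imsetP[f fS ->].
  move: fS; rewrite inE => /andP[/choicesP[fC _] fb].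
  rewrite inE; apply/andP; split.
    apply/ffun_onP => j; rewrite ffunE.
    by apply: (subsetP (CA _ (enum_valP j))); apply: fC; apply: enum_valP.
  suff -> : common_out t setT (g f) Y = common_out t S f Y by [].
  apply/setP => y; rewrite !inE; congr (_ && _).
  apply/forall_inP/forall_inP => H x xS; last by rewrite ffunE; apply/H/enum_valP.
  by have := H (enum_rank_in xS x) (in_setT _); rewrite ffunE enum_rankK_in.
move=> f f'; rewrite [f \in _]inE [f' \in _]inE.
move=> /andP[/choicesP[_ fw] _] /andP[/choicesP[_ fw'] _] e.
apply/ffunP => x; case: (boolP (x \in S)) => xS; last by rewrite fw ?fw' ?inE.
by have /ffunP/(_ (enum_rank_in xS x)) := e; rewrite !ffunE enum_rankK_in.
Qed.

(** The counting argument places layer [i] so that each nonempty in-neighbourhood has many common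
    out-neighbours in [A']; these become the candidates to which extendability of the next layer is
    applied. *)
Lemma extendable_step i (A A' R : {set W}) :
    0 < i -> [disjoint A & A' :|: R] -> room i <= #|A| ->
    (forall k, 0 < k <= d i ->
      Dout * 2 ^ ((codegree_exp i.-1).+1 * k).+1 *
        #|bad_maps t A A' (codegree_exp i) k| <= #|A| ^ k) ->
  extendable i.+1 A' R -> extendable i A (A' :|: R).
Proof.
move=> i0 dis Aroom few ext C HC.
pose J := [set v in layer i.+1 | 0 < in_degree D v].
pose S v := [set u | D u v].
pose bad v (f : T -> W) := #|common_out t (S v) f A'| * 2 ^ codegree_exp i < #|A'|.
have JP v : v \in J -> lev v = i.+1 /\ 0 < in_degree D v.
  by rewrite !inE => /andP[/eqP].
have SJ v : v \in J -> S v \subset layer i.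
  move=> /JP[vl _]; apply/subsetP => u; rewrite !inE => /lev_edge; rewrite vl.
  by case=> ->.
have two x : 0 < 2 ^ x by rewrite expn_gt0.
have [] := @valid_exists T W w0 (layer i) (sources i) J C S bad Dout.
- move=> u uU; have [_ _] := HC u uU; move: Aroom; rewrite /room.
  set n := #|_ :\: _|; move: (two (codegree_exp i.-1)).
  move: (2 ^ _) #|C u| #|A| #|sources i| n; clear; nia.
- move=> u; rewrite inE => /andP[uU /eqP u0]; have [_ -> // _] := HC u uU.
  by apply: leq_trans Aroom; rewrite /room leq_mul2l leq_addl.
- exact: SJ.
- by move=> v /JP[_]; rewrite -card_gt0.
- move=> u; apply: leq_trans (out_degree_le_max D u); apply: subset_leq_card.
  by apply/subsetP => v; rewrite !inE => /andP[].
- move=> v f g fg; rewrite /bad; congr (_ * _ < _); apply: eq_card => y.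
  rewrite !inE; congr (_ && _); apply: eq_forallb_in => x xS.
  by rewrite fg.
- move=> v vJ; have [vl vp] := JP v vJ.
  have kd : 0 < #|S v| <= d i.
    by rewrite -/(in_degree D v) vp in_degree_le_layer // inE vl.
  have CA : {in S v, forall u, C u \subset A}.
    by move=> u /(subsetP (SJ v vJ))/HC[].
  have := choices_bad_le A' (codegree_exp i) CA.
  (* Replacing [A] by candidate sets costs [2 ^ codegree_exp i.-1] per vertex; the remaining
     [2 ^ #|S v|.+1] in [few] is the factor that the counting argument demands. *)
  have prodC : #|A| ^ #|S v| <=
      \prod_(w in S v) #|C w| * 2 ^ (codegree_exp i.-1 * #|S v|).
    rewrite expnM -!prod_nat_const -big_split /=; apply: leq_prod => u.
    by move=> /(subsetP (SJ v vJ))/HC[].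
  have := leq_trans (few _ kd) prodC.
  rewrite -[(codegree_exp i.-1).+1]addn1 mulnDl mul1n -addnS expnD.
  move: #|[set f in _ | _]| #|bad_maps _ _ _ _ _| (\prod_(w in _) _).
  move: (two (codegree_exp i.-1 * #|S v|)).
  move: (2 ^ (_ * _)) (2 ^ #|S v|.+1) Dout; clear => x y z x0 a b c le1 le2.
  rewrite -(leq_pmul2r x0); apply: leq_trans le1.
  have := leq_mul (leqnn (z * (x * y))) le2; lia.
move=> f1 [f1C f1inj f1bad].
pose C' v := if in_degree D v == 0 then A' else common_out t (S v) f1 A'.
have [|f2 [f2C f2R f2inj f2D]] := ext C'.
  move=> v vl; rewrite /C'; case: eqVneq => [v0|vp].
    by split=> //; rewrite leq_pmulr.
  split=> [|v0|]; [|by rewrite v0 in vp|].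
    by apply/subsetP => y; rewrite inE => /andP[].
  have vJ : v \in J by rewrite inE vl lt0n.
  by have := f1bad v vJ; rewrite /bad -leqNgt.
have f2A u : i < lev u -> f2 u \in A' :|: R.
  rewrite leq_eqVlt inE => /predU1P[ul|/f2R->]; last by rewrite orbT.
  apply/orP; left; have := f2C u (esym ul); rewrite /C'.
  by case: ifP => // _; rewrite inE => /andP[].
have f1A u : lev u = i -> f1 u \in A.
  move=> ul; have uU : u \in layer i by rewrite inE ul.
  by have [CA _ _] := HC u uU; apply: (subsetP CA); apply: f1C.
have f12 u v : lev u = i -> i < lev v -> f1 u != f2 v.
  move=> ul vl; apply/eqP => e; have := disjointFr dis (f1A u ul).
  by rewrite e f2A.
exists (fun u => if lev u == i then f1 u else f2 u); split.
- by move=> u ul; rewrite ul eqxx f1C // inE ul.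
- by move=> u ul; rewrite gtn_eqF // f2A.
- move=> u v; rewrite !inE.
  case: ltngtP => // [ul|/esym ul] _; case: ltngtP => // [vl|/esym vl] _.
  + by apply: f2inj; rewrite inE.
  + by move=> /eqP; rewrite eq_sym (negPf (f12 _ _ _ _)).
  + by move=> /eqP; rewrite (negPf (f12 _ _ _ _)).
  + by apply: f1inj; rewrite inE ?ul ?vl.
- move=> u v ul uv; have vl := lev_edge uv.
  rewrite vl (gtn_eqF (ul : i < (lev u).+1)).
  move: ul; rewrite leq_eqVlt => /predU1P[ul|ul]; last first.
    by rewrite (gtn_eqF ul); apply: f2D.
  rewrite -ul eqxx; have := f2C v; rewrite vl ul /C' => /(_ erefl).
  have -> : (in_degree D v == 0) = false.
    by apply/negbTE; rewrite -lt0n; apply/card_gt0P; exists u; rewrite inE.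
  by rewrite inE => /andP[_ /forall_inP]; apply; rewrite inE.
Qed.

End Embedding.

(** * Choosing blocks along the median order *)

Lemma sum_mem_seq (W : finType) (s : seq W) (F : W -> nat) :
  uniq s -> \sum_(x in [set x in s]) F x = \sum_(x <- s) F x.
Proof.
by move=> us; rewrite [RHS]big_uniq //=; apply: eq_bigl => x; rewrite inE.
Qed.

Lemma count_mem_set (W : finType) (s : seq W) (a : pred W) :
  uniq s -> count a s = #|[set x in s | a x]|.
Proof.
move=> us; rewrite -size_filter -(card_uniqP (filter_uniq a us)).
by apply: eq_card => x; rewrite !inE mem_filter andbC.
Qed.

(** The median order gives density nearly 1/2 from a window of [8 * dmax] blocks to [A]; averaging
    selects one block, and dependent random choice runs inside it. *)
Lemma choose_before (W : finType) (t : rel W) (s s1 B s2 : seq W)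
    (A : {set W}) (b d dmax q p : nat) :
    median_order t s -> uniq s -> s = s1 ++ B ++ s2 -> A \subset [set x in B] ->
    0 < #|A| -> 0 < d -> 0 < q -> 0 < dmax -> 0 < b -> size B <= 2 * b ->
    8 * dmax * b <= size s1 ->
  exists s1' B' s2' (A' : {set W}), [/\ s1 = s1' ++ B' ++ s2', size B' = b,
    size s1 <= size s1' + 8 * dmax * b, A' \subset [set x in B']
    & b <= 2 ^ (q + q %/ dmax + 2) * #|A'| /\
      forall k, 0 < k <= d ->
        2 ^ (p * q) * #|bad_maps t A' A p k| <=
          2 ^ (q + q %/ dmax + 2) * d * b ^ k].
Proof.
move=> med us sE AB A0 d0 q0 dm0 b0 sB sw.
set m := 8 * dmax in sw *.
have m0 : 0 < m by rewrite muln_gt0.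
pose w := drop (size s1 - m * b) s1.
have s1E : s1 = take (size s1 - m * b) s1 ++ w by rewrite cat_take_drop.
have szw : size w = m * b by rewrite size_drop subKn.
have szt : size (take (size s1 - m * b) s1) = size s1 - m * b.
  by rewrite size_takel // leq_subr.
set s0 := take _ s1 in s1E szt.
pose g x := #|[set y in A | t x y]|.
have [w1 [B' [w2 [wE sB' heavy]]]] := heavy_block g m0 szw.
have uw : uniq w by move: us; rewrite sE s1E !cat_uniq => /andP[/and3P[]].
have uB' : uniq B' by move: uw; rewrite wE !cat_uniq => /and3P[_ _ /andP[]].
(* At least half of [w ++ B1] dominates [v]; discarding [B1], of size at most [2 * b], leaves at
   least [(m - 2) * b / 2] of these vertices in [w]. *)
have indeg v : v \in A -> (m - 2) * b <= 2 * #|[set x in w | t x v]|.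
  move=> vA; have := subsetP AB v vA; rewrite inE => /splitPr BE.
  case: BE sE sB => B1 B2 sE sB.
  have := med s0 (w ++ B1) v (B2 ++ s2).
  rewrite sE s1E -!catA /= => /(_ erefl).
  rewrite size_cat count_cat szw count_mem_set //.
  have := count_size (t^~ v) B1; move: sB; rewrite size_cat /=.
  by move: #|_|; nia.
have dens : (m - 2) * b * #|A| <= 2 * m * \sum_(x in [set x in B']) g x.
  rewrite (sum_mem_seq _ uB') -[X in _ <= X]mulnA.
  apply: (leq_trans _ (leq_mul (leqnn 2) heavy)).
  rewrite -(sum_mem_seq _ uw).
  rewrite (double_count (mem [set x in w]) (mem A) t).
  rewrite mulnC -sum_nat_const big_distrr /=; apply: leq_sum => v /indeg le.
  apply: leq_trans le _; rewrite leq_mul2l subset_leq_card ?orbT //.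
  by apply/subsetP => x; rewrite !inE.
have cB' : #|[set x in B']| = b by rewrite -sB' cardsE; apply/card_uniqP.
have [||||A' [A'B bA' few]] :=
  @dependent_random_choice W t [set x in B'] A d q p (q + (q %/ dmax).+1).
- by rewrite cB'.
- by [].
- by [].
(* The [q]-th moment is bounded below through the mean: the factor 1/2 costs [2 ^ q], and
   [(m - 2) / m] costs [2 ^ (q %/ dmax).+1]. *)
- have [q' qE] : exists q', q = q'.+1 by exists q.-1; rewrite prednK.
  have pm := power_mean [set x in B'] g q'.
  have ratio := expn_pred_ratio q dm0; rewrite -/m in ratio.
  rewrite -/g cB' in pm *; rewrite -qE in pm.
  have dq := leq_exp2r ((m - 2) * b * #|A|) (2 * m * \sum_(x in [set x in B']) g x) q0.
  rewrite dens in dq; move: dq; rewrite !expnMn -(expnMn 8) -/m => dq.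
  have mq : 0 < m ^ q by rewrite expn_gt0 m0.
  have bq : 0 < b ^ q' by rewrite expn_gt0 b0.
  rewrite expnD -(leq_pmul2r mq) -(leq_pmul2r bq).
  have bE : b ^ q = b * b ^ q' by rewrite qE expnS.
  rewrite bE in dq.
  move: (m ^ q) (2 ^ q) (2 ^ _.+1) ((m - 2) ^ q) (#|A| ^ q) (b ^ q')
    ((\sum_(x in _) g x) ^ q) (\sum_(x in _) g x ^ q) pm ratio dq.
  clear => M x y N a B S S' pm ratio dq.
  have l1 : b * a * B * M <= b * a * B * (y * N) by rewrite leq_mul2l ratio orbT.
  have l2 : y * (N * (b * B) * a) <= y * (x * M * S).
    by rewrite leq_mul2l dq orbT.
  have l3 : y * x * M * S <= y * x * M * (B * S') by rewrite leq_mul2l pm orbT.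
  lia.
rewrite cB' in bA' few; move: bA' few.
have -> : (q + (q %/ dmax).+1).+1 = q + q %/ dmax + 2 by lia.
move=> bA' few; exists (s0 ++ w1), B', (w2), A'; split=> //.
- by rewrite {1}s1E wE -!catA.
- by rewrite size_cat szt; lia.
Qed.

Lemma extendable_mono (T : finType) (D : rel T) (lev : T -> nat) (W : finType)
    (t : rel W) i (A R R' : {set W}) :
  R \subset R' -> extendable D lev t i A R -> extendable D lev t i A R'.
Proof.
move=> /subsetP RR ext C /ext[f [f1 f2 f3 f4]].
by exists f; split=> // u /f2/RR.
Qed.

Section Chain.
Variables (T : finType) (D : rel T) (lev : T -> nat) (h : nat).
Hypotheses (lev_edge : forall x y, D x y -> lev y = (lev x).+1)
  (lev_bounds : forall x, 0 < lev x <= h) (edgeD : exists x y, D x y).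
Variables (W : finType) (t : rel W) (w0 : W) (s : seq W).
Hypotheses (med : median_order t s) (us : uniq s).

Local Notation d := (layer_in D lev).
Local Notation Din := (max_in_degree D).
Local Notation block_size := (block_size D lev).

Hypothesis size_s :
  2 * (8 * Din) * \sum_(1 <= j < h.+1) block_size j <= size s.

Lemma layer_in_pos i : 0 < d i -> 0 < #|layer lev i| /\
  0 < #|layer lev i.+1 :\: sources D lev i.+1|.
Proof.
move=> di; have [v vl vd] : exists2 v, lev v == i.+1 & 0 < in_degree D v.
  apply/exists_inP; apply: contraTT di; rewrite negb_exists_in -leqNgt.
  by move=> /forall_inP H; apply/bigmax_leqP => v /H; rewrite -leqNgt.
have /card_gt0P[u] := vd; rewrite inE => uv.
split; apply/card_gt0P; [exists u|exists v]; rewrite !inE.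
  by rewrite -eqSS -(lev_edge uv).
by rewrite vl andbT /= -lt0n.
Qed.

Lemma block_size_gt0 i : 0 < d i -> 0 < block_size i.
Proof.
move=> /layer_in_pos[l0 _]; rewrite muln_gt0 expn_gt0 addn_gt0; apply/orP; left.
by rewrite !muln_gt0 (max_out_degree_gt0 edgeD) expn_gt0 l0.
Qed.

Lemma room_gt0 i : 0 < d i -> 0 < room D lev i.+1.
Proof.
move=> /layer_in_pos[_ l0].
by rewrite muln_gt0 addn_gt0 muln_gt0 expn_gt0 l0.
Qed.

(** Downward induction on the level. The reserve [8 * Din * b] closes the budget: passing to
    [b' = M + b / 2] consumes at most [8 * Din * b'] vertices and reserves as much again, which
    together is at most [2 * (8 * Din) * M + 8 * Din * b]. *)
Lemma extendable_chain k : k <= h -> let i := h.+1 - k in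
  exists s1 B s2 (A : {set W}) b,
    [/\ s = s1 ++ B ++ s2, size B <= b /\ A \subset [set x in B],
      room D lev i <= #|A|,
      size s + 8 * Din * b <=
        size s1 + 2 * (8 * Din) * \sum_(i <= j < h.+1) block_size j
    & extendable D lev t i A [set x in s2]].
Proof.
move=> kh /=.
elim: k kh => [|k IH] kh.
  (* The start is an empty block at the end of [s]; [room] vanishes because level [h.+1] is
     empty. *)
  rewrite subn0; exists s, [::], [::], set0, 0; split; rewrite ?cats0 ?sub0set ?cards0 //.
  - rewrite leqn0 muln_eq0 /= addn_eq0 muln_eq0; apply/andP; split.
      apply/orP; right; rewrite cards_eq0; apply/eqP/setP => v; rewrite !inE.
      case: eqP => [vl|_]; last by rewrite andbF.
      by have := lev_bounds v; rewrite vl ltnn andbF.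
    rewrite cards_eq0; apply/eqP/setP => v; rewrite !inE.
    case: eqP => [vl|//]; by have := lev_bounds v; rewrite vl ltnn andbF.
  - by rewrite muln0 addn0 leq_addr.
  - exact: extendable_top w0 _.
have [s1 [B [s2 [A [b [sE [sB AB] Aroom sz ext]]]]]] := IH (ltnW kh).
set i := h.+1 - k.+1.
have iE : h.+1 - k = i.+1 by rewrite /i; lia.
have i0 : 0 < i by rewrite /i; lia.
have ih : i < h.+1 by rewrite /i; lia.
rewrite {}iE in Aroom sz ext.
rewrite (big_ltn ih).
have [M ME] : exists M, M = block_size i by exists (block_size i).
(* Half of the previous bound is added because [choose_before] needs [B] to have at most [2 * b']
   vertices. *)
rewrite -ME; set b' := M + b./2.
have D0 := max_in_degree_gt0 edgeD.
have szM : 2 * (8 * Din) * M + 8 * Din * b <= size s1.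
  have sumE : \sum_(1 <= j < h.+1) block_size j =
      \sum_(1 <= j < i) block_size j + (M + \sum_(i.+1 <= j < h.+1) block_size j).
    by rewrite (big_cat_nat i0 (ltnW ih)) (big_ltn ih) ME.
  have := size_s; rewrite sumE; move: sz.
  move: (\sum_(1 <= j < i) _) (\sum_(i.+1 <= j < h.+1) _) (8 * Din).
  clear => x y z; rewrite !mulnDr; move: (2 * z * x) (2 * z * y) (2 * z * M); lia.
have b2 : 2 * b' <= 2 * M + b by rewrite /b'; clear; lia.
have szb' : 8 * Din * b' <= size s1.
  by apply: leq_trans szM; move: (8 * Din) b2 => m; clear; nia.
have step : size s + 8 * Din * b' <= size s1 - 8 * Din * b' +
    2 * (8 * Din) * (M + \sum_(i.+1 <= j < h.+1) block_size j).
  move: sz szb'; move: (\sum_(i.+1 <= j < h.+1) _) (8 * Din) => S m sz szb'.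
  have : m * (2 * b') <= m * (2 * M + b) by rewrite leq_mul2l b2 orbT.
  rewrite !mulnDr; move: sz szb'; clear; lia.
have roomM := room_le lev_edge edgeD i0; rewrite -ME in roomM.
have disj s1' B' s2' (A' : {set W}) : s1 = s1' ++ B' ++ s2' ->
    A' \subset [set x in B'] -> [disjoint A' & A :|: [set x in s2]].
  move=> s1E A'B; rewrite disjoint_subset.
  apply/subsetP => x /(subsetP A'B); rewrite inE => xB'.
  rewrite inE; apply/negP => xA.
  have : x \in B ++ s2.
    rewrite mem_cat; move: xA; rewrite inE.
    by case/orP => [/(subsetP AB)|]; rewrite inE => ->; rewrite ?orbT.
  have : x \in s1 by rewrite s1E !mem_cat xB' orbT.
  move: us; rewrite sE cat_uniq => /and3P[_ /hasPn H _] xs1 /H /=.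
  by rewrite xs1.
have subR s2' : A :|: [set x in s2] \subset [set x in s2' ++ B ++ s2].
  apply/subsetP => x; rewrite !inE !mem_cat.
  by case/orP => [/(subsetP AB)|]; rewrite ?inE => ->; rewrite !orbT.
(* If no edge enters level [i.+1], there are no tuples to control, and the last [b'] vertices of
   [s1] serve as [A_i]. *)
case: (posnP (d i)) => [di|di].
  pose B' := drop (size s1 - b') s1.
  have s1E : s1 = take (size s1 - b') s1 ++ B' ++ [::].
    by rewrite cats0 cat_take_drop.
  have szB' : size B' = b'.
    by rewrite size_drop subKn //; move: szb' D0; clear; nia.
  have uB' : uniq B' by rewrite drop_uniq //; move: us; rewrite sE cat_uniq => /and3P[].
  have cB' : #|[set x in B']| = b' by rewrite -szB' cardsE; apply/card_uniqP.
  have roomb : room D lev i <= #|[set x in B']|.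
    rewrite cB'; apply: leq_trans (leq_trans roomM (leq_addr _ _)).
    by rewrite leq_pmulr // expn_gt0.
  exists (take (size s1 - b') s1), B', (B ++ s2), [set x in B'], b'; split=> //.
  - by rewrite {1}sE {1}s1E cats0 -!catA.
  - by rewrite szB' leqnn.
  - apply: leq_trans step _; rewrite leq_add2r size_takel ?leq_subr // leq_sub2l //.
    by move: D0; clear; nia.
  - apply: extendable_mono (subR [::]) _.
    apply: (extendable_step lev_edge w0 i0 _ roomb _ ext).
      exact: disj s1E (subxx _).
    by move=> j /andP[j0]; rewrite di leqn0 => /eqP j1; rewrite j1 in j0.
have M0 := block_size_gt0 di; rewrite -ME in M0.
have A0 : 0 < #|A| by apply: leq_trans Aroom; apply: room_gt0.
have sB' : size B <= 2 * b'.
  by apply: leq_trans sB _; rewrite /b'; move: M0; clear; lia.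
have q0 : 0 < samples D lev i.
  by rewrite /samples !leq_max muln_gt0 di.
have b'0 : 0 < b' by rewrite addn_gt0 M0.
have [s1' [B' [s2' [A' [s1E szB' sz1 A'B [big few]]]]]] :=
  choose_before (codegree_exp D lev i) med us sE AB A0 di q0 D0 b'0 sB' szb'.
rewrite -/(density_exp D lev i) in big few.
have rA : room D lev i <= #|A'|.
  have two : 0 < 2 ^ density_exp D lev i by rewrite expn_gt0.
  rewrite -(leq_pmul2r two); apply: leq_trans roomM _.
  by rewrite [X in _ <= X]mulnC; apply: leq_trans big; apply: leq_addr.
exists s1', B', (s2' ++ B ++ s2), A', b'; split=> //.
- by rewrite {1}sE {1}s1E -!catA.
- by rewrite szB' leqnn.
- by apply: leq_trans step _; rewrite leq_add2r leq_subLR addnC.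
- apply: extendable_mono (subR s2') _.
  apply: (extendable_step lev_edge w0 i0 _ rA _ ext); first exact: disj s1E A'B.
  (* The bound relative to the block size [b'] becomes one relative to [#|A'|], which costs the
     factor [2 ^ (density_exp i * j)] foreseen in [exponents_ok]. *)
  move=> j jd; have := few j jd; have := exponents_ok edgeD jd.
  have := leq_exp2r b' (2 ^ density_exp D lev i * #|A'|) (proj1 (andP jd)).
  rewrite big expnMn -expnM => pwb.
  have two : 0 < 2 ^ (codegree_exp D lev i * samples D lev i) by rewrite expn_gt0.
  move=> l2 l3; rewrite -(leq_pmul2l two); move: pwb l2 l3.
  move: (max_out_degree D * _) #|bad_maps _ _ _ _ _| (2 ^ density_exp D lev i)
    (2 ^ (density_exp D lev i * j))
    (#|A'| ^ j) (b' ^ j) (2 ^ (_ * samples D lev i)) (d i).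
  clear => x c y z a u p e l1 l2 l3.
  have m1 : x * (p * c) <= x * (y * e * u) by rewrite leq_mul2l l3 orbT.
  have m2 : x * y * e * u <= x * y * e * (z * a) by rewrite leq_mul2l l1 orbT.
  have m3 : a * (x * (y * e * z)) <= a * p by rewrite leq_mul2l l2 orbT.
  move: m1 m2 m3; clear; lia.
Qed.

Lemma copy_of_levels : contains_copy D t.
Proof.
have [s1 [B [s2 [A [b [_ _ _ _ ext]]]]]] := extendable_chain (leqnn h).
rewrite subSnn in ext.
have [|f [_ _ finj fD]] := ext (fun=> A).
  by move=> u _; split=> //; rewrite leq_pmulr // expn_gt0.
have lev0 u : 0 < lev u by case/andP: (lev_bounds u).
apply/contains_copyP; exists f => [u v|u v]; last exact: fD.
by apply: finj; rewrite inE.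
Qed.

End Chain.

(** * From graded partitions to levels, and the final bound *)

Lemma graded_partition_level (T : finType) (D : rel T) h (V : nat -> {set T}) :
  graded_partition D h V ->
  exists lev : T -> nat, [/\ forall x, 0 < lev x <= h,
    forall x i, 0 < i <= h -> (x \in V i) = (lev x == i)
    & forall x y, D x y -> lev y = (lev x).+1].
Proof.
case=> cov dis edge.
have ex x : exists i, (0 < i <= h) && (x \in V i).
  have : x \in \bigcup_(1 <= i < h.+1) V i by rewrite cov inE.
  rewrite big_seq; elim/big_rec: _ => [|i B]; first by rewrite inE.
  rewrite mem_index_iota ltnS => ih IH; rewrite inE => /orP[xi|//].
  by exists i; rewrite ih.
pose lev x := xchoose (ex x).
have levP x : (0 < lev x <= h) && (x \in V (lev x)) by apply: (xchooseP (ex x)).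
have uni x i : 0 < i <= h -> (x \in V i) = (lev x == i).
  have /andP[lx xl] := levP x => ih.
  apply/idP/eqP => [xi|<-//]; apply/eqP; apply: contraT => ne.
  by rewrite (disjointFr (dis _ _ lx ih ne) xl) in xi.
exists lev; split=> // [x|x y /edge[i ih /andP[xi yi]]]; first by case/andP: (levP x).
have h1 : 0 < i <= h by lia.
have h2 : 0 < i.+1 <= h by lia.
by move: xi yi; rewrite !uni // => /eqP-> /eqP->.
Qed.

Section Levels.
Variables (T : finType) (D : rel T) (h : nat) (V : nat -> {set T}) (lev : T -> nat).
Hypotheses (lev_bounds : forall x, 0 < lev x <= h)
  (levV : forall x i, 0 < i <= h -> (x \in V i) = (lev x == i))
  (lev_edge : forall x y, D x y -> lev y = (lev x).+1).

(** Edges into level [i.+1] come from level [i], so the whole in-degree is seen in the induced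
    subgraph. *)
Lemma layer_in_le_induced i : layer_in D lev i <= layer_in_degree D h V i.
Proof.
apply/bigmax_leqP => v /eqP vl; case: (posnP (in_degree D v)) => [->//|].
move=> /card_gt0P[u]; rewrite inE => /lev_edge; rewrite vl => -[ul].
have i0 : 0 < i by have := lev_bounds u; rewrite ul => /andP[].
have ih : i < h by have := lev_bounds v; rewrite vl => /andP[].
have i1 : 1 <= i <= h - 1 by lia.
rewrite /layer_in_degree i1.
have h1 : 0 < i <= h by lia.
have h2 : 0 < i.+1 <= h by lia.
have vV : v \in V i :|: V i.+1 by rewrite inE !levV // vl eqxx orbT.
apply: leq_trans (leq_bigmax (Sub v vV : {x | x \in V i :|: V i.+1})).
rewrite /in_degree -(card_imset _ val_inj); apply: subset_leq_card.
apply/subsetP => w; rewrite inE => wv; apply/imsetP.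
have wV : w \in V i :|: V i.+1.
  have := lev_edge wv; rewrite vl => -[wl].
  by rewrite inE !levV // -wl eqxx.
by exists (Sub w wV); rewrite // inE.
Qed.

Lemma card_layer_part i : 0 < i <= h -> #|layer lev i| = #|V i|.
Proof. by move=> ih; apply: eq_card => x; rewrite inE levV. Qed.

(** Each layer weight enters at most two block sizes, hence the factor 2; level 0 is empty, so the
    shifted sum is no larger. *)
Lemma sum_block_size_le :
  \sum_(1 <= i < h.+1) block_size D lev i <=
    2 ^ 24 * (2 * (max_out_degree D * \sum_(1 <= i < h.+1)
      2 ^ (2 * (layer_in_degree D h V i.-1 + layer_in_degree D h V i)) * #|V i|)).
Proof.
have : \sum_(1 <= i < h.+1) layer_weight D lev i <=
    max_out_degree D * \sum_(1 <= i < h.+1)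
      2 ^ (2 * (layer_in_degree D h V i.-1 + layer_in_degree D h V i)) * #|V i|.
  rewrite big_distrr /= [X in X <= _]big_nat [X in _ <= X]big_nat; apply: leq_sum => i ih.
  rewrite /layer_weight mulnA card_layer_part // leq_mul2r leq_mul2l.
  rewrite leq_exp2l // leq_mul2l.
  by rewrite leq_add ?layer_in_le_induced ?orbT.
have : \sum_(1 <= i < h.+1) layer_weight D lev i.-1 <=
       \sum_(1 <= i < h.+1) layer_weight D lev i.
  rewrite big_add1 /=; case: (posnP h) => [->|h0]; first by rewrite big_nil.
  rewrite big_ltn //.
  have -> : layer_weight D lev 0 = 0.
    apply/eqP; rewrite muln_eq0; apply/orP; right; rewrite cards_eq0.
    apply/eqP/setP => x; rewrite !inE.
    by have /andP[] := lev_bounds x; case: (lev x).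
  by rewrite [X in _ <= X]big_nat_recr //= leq_addr.
have sumK K : \sum_(1 <= i < h.+1) K * (layer_weight D lev i + layer_weight D lev i.-1) =
    K * (\sum_(1 <= i < h.+1) layer_weight D lev i +
         \sum_(1 <= i < h.+1) layer_weight D lev i.-1).
  by rewrite -big_distrr big_split.
move=> le1 le2; rewrite /block_size sumK.
apply: (leq_mul (leqnn _)); move: le1 le2.
move: (\sum_(_ <= _ < _) _) (\sum_(_ <= _ < _) _) (max_out_degree D * _).
by clear => x y z xy yz; lia.
Qed.

End Levels.

Theorem theorem2p1 (T : finType) (D : rel T) (h : nat) (V : nat -> {set T})
    (gradedD : graded_partition D h V)
    (edgeD : exists x y : T, D x y) :
  oriented_ramsey (graded_acyclic gradedD) <=
    10 ^ 9 * max_in_degree D ^ 2 * max_out_degree D *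
    \sum_(1 <= i < h.+1)
      2 ^ (2 * (layer_in_degree D h V i.-1 + layer_in_degree D h V i)) * #|V i|.
Proof.
have [lev [lev_bounds levV lev_edge]] := graded_partition_level gradedD.
have sums := sum_block_size_le lev_bounds levV lev_edge.
rewrite /oriented_ramsey; case: ex_minnP => m _; apply.
apply/unavoidableP => W t WN tt.
have Din0 := max_in_degree_gt0 edgeD.
have Dout0 := max_out_degree_gt0 edgeD.
(* A nonempty [W] supplies the default value [w0] of partial maps. *)
have W0 : 0 < #|W|.
  rewrite WN muln_gt0 muln_gt0 muln_gt0 (expn_gt0 10) (expn_gt0 _ 2) Din0 Dout0 /=.
  have [x _] := edgeD; have xl := lev_bounds x.
  rewrite (bigD1_seq (lev x)) ?mem_index_iota ?iota_uniq //=.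
  rewrite addn_gt0 muln_gt0 expn_gt0 /=; apply/orP; left.
  by apply/card_gt0P; exists x; rewrite levV.
have /card_gt0P[w0 _] := W0.
have [s sW med] := median_order_exists tt.
have us : uniq s by rewrite (perm_uniq sW) enum_uniq.
apply: (copy_of_levels lev_edge lev_bounds edgeD w0 med us).
rewrite (perm_size sW) -cardE WN.
apply: leq_trans (leq_mul (leqnn _) sums) _.
(* The factor [2 * 8] comes from the length budget, [2 ^ 24] from [block_size], and the last 2 from
   counting layer weights twice. Splitting into powers of 2 and 5 avoids computing large unary
   numbers. *)
have const : 2 * 8 * 2 ^ 24 * 2 <= 10 ^ 9.
  have -> : 2 * 8 * 2 ^ 24 * 2 = 2 ^ 9 * (2 ^ 9 * 2 ^ 11).
    rewrite (_ : 2 * 8 = 2 ^ 4); last by [].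
    by rewrite -expnD -expnSr -!expnD.
  have -> : 10 ^ 9 = 2 ^ 9 * (5 ^ 4 * 5 ^ 5) by rewrite -expnD -expnMn.
  exact: leq_mul (leqnn _) (leq_mul (isT : 2 ^ 9 <= 5 ^ 4) (isT : 2 ^ 11 <= 5 ^ 5)).
rewrite -[X in _ <= X]mulnA; move: (max_out_degree D * _) const => S.
move: (2 ^ 24) (10 ^ 9) (max_in_degree D) Din0; clear => K L Din Din0 KL.
have -> : 2 * (8 * Din) * (K * (2 * S)) = 2 * 8 * K * 2 * (Din * S) by lia.
(* The argument yields the first power of [Din], which is at most its square. *)
by rewrite -[X in _ <= X]mulnA leq_mul // leq_mul2r -{1}(expn1 Din) leq_pexp2l // orbT.
Qed.
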